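(* For each $d\ge2$ let $f^{(d)}\in C(\mathbb{S}^{d-1})$. Assume that for every $d$ there exists $I_d\subseteq\mathbb{N}$ such that, for some constants $M>0$, $\epsilon\in(0,1)$, $\alpha>0$ independent of $d$: 1. $\|f^{(d)}\|_2\le O(d^M)\cdot\|\mathcal{P}_{I_d}f^{(d)}\|_2$; 2. there exists a non-negative sequence $\{c_{d,k}\}_{k\in I_d}$ such that $\|f_k^{(d)}\|_\infty\le c_{d,k}\sqrt{N_k^d}\,\|f^{(d)}\|_2$ for all $k\in I_d$ and $\left(\sum_{k\in I_d}c_{d,k}^2\right)^{1/2}\le\epsilon^{d^\alpha}\cdot O(d^M)$. Moreover, assume that $\|f^{(d)}\|_\infty=O(1)$ and $\|f^{(d)}\|_2=\Omega(d^{-M})$. Then, for every Lipschitz activation $\sigma:\mathbb{R}\to\mathbb{R}$, the sequence $\{f^{(d)}\}_d$ is not universally approximable by one-hidden-layer networks with activation $\sigma$.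
   Context: $\mathbb{S}^{d-1}$ is the unit sphere of $\mathbb{R}^d$ with the uniform probability measure $S$; $\|\cdot\|_2$ is the norm of $L^2(S)$ and $\|\cdot\|_\infty$ the sup norm on $\mathbb{S}^{d-1}$. $H_k^d$ is the space of spherical harmonics of degree $k$ (restrictions to $\mathbb{S}^{d-1}$ of homogeneous harmonic polynomials of degree $k$), $N_k^d=\dim H_k^d$, $f_k$ denotes the orthogonal projection in $L^2(S)$ of $f$ onto $H_k^d$, and $\mathcal{P}_I f=\sum_{k\in I}f_k$ for $I\subseteq\mathbb{N}=\{0,1,2,\dots\}$. $O(\cdot)$, $\Omega(\cdot)$ refer to $d\to\infty$. A one-hidden-layer network with activation $\sigma$ and $N$ units is $f_N(\mathbf{x})=\sum_{j=1}^N u_j\sigma(\mathbf{a}_j^T\mathbf{x}+b_j)$ with $u_j\in\mathbb{C}$, $\mathbf{a}_j\in\mathbb{R}^d$, $b_j\in\mathbb{R}$, and $m_\infty(f_N)=\max\{\max_j\|\mathbf{a}_j\|_\infty,\max_j|u_j|\}$. The sequence $\{f^{(d)}\}_d$ is universally approximable by one-hidden-layer networks with activation $\sigma$ if there exist constants $A,B>0$ such that for every $d$ and every $\delta\in(0,1)$ there is such a network $f_N$ with $\sup_{\mathbf{x}\in\mathbb{S}^{d-1}}|f^{(d)}(\mathbf{x})-f_N(\mathbf{x})|\le\delta$ and $N+m_\infty(f_N)\le A(d\delta^{-1})^B$. *)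

(* Defs.v *)
From HB Require Import structures.
From mathcomp Require Import all_boot all_order all_algebra.
From mathcomp Require mpoly.
(* the notations of mpoly clash with those of MathComp-Analysis *)
Import -(notations) mpoly.
From mathcomp Require Import all_classical all_reals all_analysis.
From mathcomp Require Import complex.

Set Implicit Arguments.
Unset Strict Implicit.
Unset Printing Implicit Defensive.

Import Order.TTheory GRing.Theory Num.Theory.
Import numFieldNormedType.Exports.

Local Open Scope classical_set_scope.
Local Open Scope ring_scope.

Notation normc := (@ComplexField.Normc.normc _).

Definition dotp (R : realType) (m : nat) (x y : 'rV[R]_m) : R :=
  \sum_(i < m) x 0 i * y 0 i.

(* [sphere R n] is the unit sphere S^n of R^(n+1), with the subspace topology
   and its Borel sigma-algebra: the sphere S^(d-1) of R^d is [sphere R d.-1].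
   The shift keeps the type inhabited, as [measurableType] requires. *)
Definition sphere (R : realType) (n : nat) : Type :=
  set_type [set x : 'rV[R]_n.+1 | dotp x x = 1].

Fact sphere_point_subproof (R : realType) (n : nat) :
  (delta_mx 0 0 : 'rV[R]_n.+1) \in [set x : 'rV[R]_n.+1 | dotp x x = 1].
Proof.
apply/mem_set; rewrite /= /dotp (bigD1 ord0) //= big1 => [|i i0].
  by rewrite !mxE eqxx mulr1 addr0.
by rewrite !mxE eqxx (negPf i0) mulr0.
Qed.

HB.instance Definition _ (R : realType) (n : nat) :=
  Topological.on (sphere R n).
HB.instance Definition _ (R : realType) (n : nat) :=
  isPointed.Build (sphere R n) (SigSub (sphere_point_subproof R n)).
HB.instance Definition _ (R : realType) (n : nat) :=
  Measurable.copy (sphere R n) (g_sigma_algebraType (@open (sphere R n))).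

Definition spoint (R : realType) (n : nat) (x : sphere R n) : 'rV[R]_n.+1 :=
  set_val x.

(* The uniform probability measure on S^n is the unique Borel probability
   measure invariant under the orthogonal group O(n+1). *)
Definition uniform_sphere (R : realType) (n : nat)
    (S : probability (sphere R n) R) : Prop :=
  forall Q : 'M[R]_n.+1, Q *m Q^T = 1%:M ->
  forall A : set (sphere R n), measurable A ->
  S [set y | exists2 x, A x & spoint y = spoint x *m Q] = S A.

(* [^o] only selects the topology given by the modulus on R[i]. *)
Definition ccontinuous (R : realType) (n : nat) (f : sphere R n -> R[i]) :
    Prop :=
  continuous (f : sphere R n -> R[i]^o).

Definition supnorm (R : realType) (n : nat) (f : sphere R n -> R[i]) : \bar R :=
  ereal_sup (range (fun x => (normc (f x))%:E)).

Definition l2norm (R : realType) (n : nat) (S : probability (sphere R n) R)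
    (f : sphere R n -> R[i]) : \bar R :=
  ('N[S]_(2%:E)[(fun x => (normc (f x))%:E)])%E.

Definition in_L2 (R : realType) (n : nat) (S : probability (sphere R n) R)
    (f : sphere R n -> R[i]) : Prop :=
  [/\ measurable_fun setT (fun x => complex.Re (f x)),
      measurable_fun setT (fun x => complex.Im (f x)) & (l2norm S f < +oo)%E].

Definition l2inner (R : realType) (n : nat) (S : probability (sphere R n) R)
    (f g : sphere R n -> R[i]) : R[i] :=
  ((\int[S]_x complex.Re (f x * conjc (g x)))%R
     +i* (\int[S]_x complex.Im (f x * conjc (g x)))%R)%C.

Definition laplacian (K : nzRingType) (m : nat) (p : mpoly m K) : mpoly m K :=
  \sum_(i < m) mderiv i (mderiv i p).

(* [harmonics R n k] is H_k^d for d = n.+1, with complex coefficients. *)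
Definition harmonics (R : realType) (n k : nat) : set (sphere R n -> R[i]) :=
  [set h | exists p : mpoly n.+1 R[i],
     [/\ p \is ishomog1 k (mdeg : mpoly.Measure.type n.+1),
         laplacian p = 0 &
         forall x, h x = meval (fun i => (spoint x 0 i)%:C%C) p]].

Definition is_basis (R : realType) (n : nat) (V : set (sphere R n -> R[i]))
    (m : nat) (e : 'I_m -> sphere R n -> R[i]) : Prop :=
  (forall i, V (e i)) /\
  (forall g, V g -> exists! c : 'rV[R[i]]_m,
     forall x, g x = \sum_(i < m) c 0 i * e i x).

Definition cdim (R : realType) (n : nat) (V : set (sphere R n -> R[i])) : nat :=
  xget 0%N [set m | exists e : 'I_m -> sphere R n -> R[i], is_basis V e].

(* The component f_k: the orthogonal projection of f onto the spherical
   harmonics of degree k. *)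
Definition hproj (R : realType) (n : nat) (S : probability (sphere R n) R)
    (k : nat) (f : sphere R n -> R[i]) : sphere R n -> R[i] :=
  xget (fun=> 0) [set g | harmonics k g /\
    forall h, harmonics k h -> l2inner S (fun x => f x - g x) h = 0].

(* P_I f, the sum of the components f_k over k in I; the series converges in
   L^2(S), and P_I f is a representative of its sum, unique S-a.e. *)
Definition band_proj (R : realType) (n : nat) (S : probability (sphere R n) R)
    (I : set nat) (f : sphere R n -> R[i]) : sphere R n -> R[i] :=
  xget (fun=> 0) [set g | in_L2 S g /\
    l2norm S (fun x => g x - \sum_(k < m | `[< I k >]) hproj S k f x)
      @[m --> \oo] --> 0%E].

Definition network (R : realType) (sigma : R -> R) (n N : nat)
    (u : 'I_N -> R[i]) (a : 'I_N -> 'rV[R]_n.+1) (b : 'I_N -> R)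
    (x : sphere R n) : R[i] :=
  \sum_(j < N) u j * (sigma (dotp (a j) (spoint x) + b j))%:C%C.

(* The norm [`|a j|] of a row vector is its sup norm. *)
Definition max_weight (R : realType) (n N : nat)
    (u : 'I_N -> R[i]) (a : 'I_N -> 'rV[R]_n.+1) : R :=
  Num.max (\big[Num.max/0]_(j < N) `|a j|)
          (\big[Num.max/0]_(j < N) normc (u j)).

Definition universally_approximable (R : realType) (sigma : R -> R)
    (f : forall d : nat, sphere R d.-1 -> R[i]) : Prop :=
  exists A B : R, [/\ 0 < A, 0 < B &
    forall d : nat, (2 <= d)%N ->
    forall delta : R, 0 < delta < 1 ->
    exists (N : nat) (u : 'I_N -> R[i]) (a : 'I_N -> 'rV[R]_d.-1.+1)
           (b : 'I_N -> R),
      (supnorm (fun x => f d x - network sigma u a b x)%R <= delta%:E)%E /\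
      N%:R + max_weight u a <= A * (d%:R * delta^-1) `^ B].

(* Main.v *)
(* A ridge function x |-> phi (<x, e>) on the sphere pairs with H_k only
   through evaluation at e, because the zonal functions in H_k form a line. As
   the reproducing kernel of H_k at e has squared norm N_k, condition 2 gives
     |<f_k, ridge>| <= c_k ||f|| ||ridge_k||,
   where ridge_k is the component of the ridge in H_k; by Cauchy-Schwarz over
   k in I,
     |<P_I f, ridge>| <= (sum_k c_k^2)^(1/2) ||f|| ||ridge||,
   which is exponentially small. If a network with polynomially many units and
   weights were within delta = d^-(2M+1) of f, then ||P_I f||^2 = <f, P_I f>
   would be at most delta ||P_I f|| plus a polynomial times this exponentially
   small quantity, contradicting the lower bounds on ||P_I f|| and ||f||. The
   biases are not bounded, so each unit is first centered, as
   sigma (<a, x> + b) - sigma b; the constants collected in this way form one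
   more ridge function, bounded since f is bounded.

   That a zonal harmonic is determined by its value at the pole, that the
   reproducing kernel is constant on the diagonal, and that harmonics of
   different degrees are orthogonal all follow from the infinitesimal rotations
   x_u d_v - x_v d_u, which are skew-adjoint for the invariant measure.

   P_I f enters only through its partial sums. The default values of [hproj],
   [band_proj] and [cdim] are harmless: they are 0, and a zero N_k or a zero
   P_I f makes the corresponding bound trivial or contradictory. *)
Require Import Defs.
From HB Require Import structures.
From mathcomp Require Import all_boot all_order all_algebra.
From mathcomp Require mpoly.
Import -(notations) mpoly.
From mathcomp Require Import all_classical all_reals all_analysis.
From mathcomp Require Import measurable_realfun complex ring lra.

Set Implicit Arguments.
Unset Strict Implicit.
Unset Printing Implicit Defensive.

Import Order.TTheory GRing.Theory Num.Theory.
Import numFieldNormedType.Exports.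
Local Open Scope classical_set_scope.
Local Open Scope ring_scope.

Local Notation "''X_' i" := (mpolyX _ (mnm1 i)) : ring_scope.
Local Notation homog k := (ishomog1 k (mdeg : mpoly.Measure.type _)).

(** * Infinitesimal rotations of polynomials *)

Section LinearForms.
Context (K : numFieldType) (m : nat).
Implicit Types (p q : mpoly m K) (u v w : 'rV[K]_m) (i j : 'I_m) (k : nat).

Definition linmp u : mpoly m K := \sum_i u 0 i *: 'X_i.
Definition dirderiv v p : mpoly m K := \sum_i v 0 i *: mderiv i p.
End LinearForms.

(* Locked, because conversion checks that unfold it do not terminate in
   practice. *)
HB.lock Definition rotd (K : numFieldType) (m : nat) (u v : 'rV[K]_m)
    (p : mpoly m K) : mpoly m K :=
  linmp u * dirderiv v p - linmp v * dirderiv u p.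

Section Derivations.
Context (K : numFieldType) (m : nat).
Implicit Types (p q : mpoly m K) (u v w : 'rV[K]_m) (i j : 'I_m) (k : nat).

Lemma rotdE u v p :
  rotd u v p = linmp u * dirderiv v p - linmp v * dirderiv u p.
Proof. by rewrite rotd.unlock. Qed.

Lemma mderivXE i j : mderiv i ('X_j : mpoly m K) = (i == j)%:R.
Proof.
rewrite mderivX mnm1E eq_sym; case: eqVneq => [->|_]; last by rewrite scale0r.
rewrite scale1r -mpolyX0; congr mpolyX.
by apply/mnmP=> l; rewrite mnmBE mnm0E subnn.
Qed.

Lemma linmp_is_linear : linear (@linmp K m).
Proof.
move=> c u v; rewrite /linmp scaler_sumr -big_split /=; apply: eq_bigr => i _.
by rewrite !mxE scalerDl scalerA.
Qed.
HB.instance Definition _ :=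
  GRing.isLinear.Build K 'rV[K]_m (mpoly m K) _ (@linmp K m) linmp_is_linear.

Lemma linmp_delta i : linmp (delta_mx 0 i : 'rV[K]_m) = 'X_i.
Proof.
rewrite /linmp (bigD1 i) //= big1 => [|j /negPf ji].
  by rewrite !mxE !eqxx scale1r addr0.
by rewrite !mxE ji scale0r.
Qed.

Lemma dirderiv_is_linear v : linear (dirderiv v).
Proof.
move=> c p q; rewrite /dirderiv scaler_sumr -big_split /=.
apply: eq_bigr => i _.
by rewrite linearP scalerDr !scalerA mulrC.
Qed.
HB.instance Definition _ v :=
  GRing.isLinear.Build K (mpoly m K) (mpoly m K) _ (dirderiv v)
    (dirderiv_is_linear v).

Lemma dirderiv_delta i p : dirderiv (delta_mx 0 i) p = mderiv i p.
Proof.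
rewrite /dirderiv (bigD1 i) //= big1 => [|j /negPf ji].
  by rewrite !mxE !eqxx scale1r addr0.
by rewrite !mxE ji scale0r.
Qed.

Lemma dirderivP c u v p :
  dirderiv (c *: u + v) p = c *: dirderiv u p + dirderiv v p.
Proof.
rewrite /dirderiv scaler_sumr -big_split /=; apply: eq_bigr => i _.
by rewrite !mxE scalerDl scalerA.
Qed.

Lemma dirderivM v p q :
  dirderiv v (p * q) = dirderiv v p * q + p * dirderiv v q.
Proof.
rewrite /dirderiv mulr_suml mulr_sumr -big_split /=; apply: eq_bigr => i _.
by rewrite mderivM scalerDr scalerAl scalerAr.
Qed.

Lemma dirderiv_mderiv v i p :
  dirderiv v (mderiv i p) = mderiv i (dirderiv v p).
Proof.
rewrite /dirderiv linear_sum; apply: eq_bigr => j _.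
by rewrite linearZ /= mderiv_comm.
Qed.

Lemma mderiv_linmp i u : mderiv i (linmp u) = mpolyC m (u 0 i).
Proof.
rewrite linear_sum (bigD1 i) //= big1 => [|j /negPf ji].
  by rewrite linearZ /= mderivXE eqxx addr0 -mul_mpolyC mulr1.
by rewrite linearZ /= mderivXE eq_sym ji scaler0.
Qed.

Lemma rotd_is_linear u v : linear (rotd u v).
Proof.
by move=> c p q; rewrite !rotdE !linearP !mulrDr -!scalerAr scalerBr; ring.
Qed.
HB.instance Definition _ u v :=
  GRing.isLinear.Build K (mpoly m K) (mpoly m K) _ (rotd u v)
    (rotd_is_linear u v).

Lemma rotdD u v p q : rotd u v (p + q) = rotd u v p + rotd u v q.
Proof. exact: linearD. Qed.

Lemma rotdM u v p q : rotd u v (p * q) = rotd u v p * q + p * rotd u v q.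
Proof. by rewrite !rotdE !dirderivM; ring. Qed.

Lemma rotdPl c u w v p : rotd (c *: u + w) v p = c *: rotd u v p + rotd w v p.
Proof.
by rewrite !rotdE linearP dirderivP !mulrDl mulrDr -!scalerAl -!scalerAr scalerBr; ring.
Qed.

Lemma rotdC u v p : rotd u v p = - rotd v u p.
Proof. by rewrite !rotdE opprB. Qed.

Lemma rotdPr c u w v p : rotd v (c *: u + w) p = c *: rotd v u p + rotd v w p.
Proof. by rewrite rotdC rotdPl opprD -scalerN -!rotdC. Qed.

Lemma rotd_id u p : rotd u u p = 0.
Proof. by rewrite !rotdE subrr. Qed.

Lemma rotd_delta i j p :
  rotd (delta_mx 0 i) (delta_mx 0 j) p = 'X_i * mderiv j p - 'X_j * mderiv i p.
Proof. by rewrite !rotdE !linmp_delta !dirderiv_delta. Qed.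

Lemma laplacian_is_linear : linear (@laplacian K m).
Proof.
move=> c p q; rewrite /laplacian scaler_sumr -big_split /=.
by apply: eq_bigr => i _; rewrite !linearP.
Qed.
HB.instance Definition _ :=
  GRing.isLinear.Build K (mpoly m K) (mpoly m K) _ (@laplacian K m)
    laplacian_is_linear.

Lemma laplacian_mderiv i p : laplacian (mderiv i p) = mderiv i (laplacian p).
Proof.
rewrite /laplacian linear_sum; apply: eq_bigr => j _ /=.
by rewrite (mderiv_comm i) (mderiv_comm i).
Qed.

Lemma laplacian_dirderiv v p :
  laplacian (dirderiv v p) = dirderiv v (laplacian p).
Proof.
rewrite /dirderiv linear_sum; apply: eq_bigr => j _ /=.
by rewrite linearZ /= laplacian_mderiv.
Qed.

Lemma laplacian_linmpM u p :
  laplacian (linmp u * p) = linmp u * laplacian p + dirderiv u p *+ 2.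
Proof.
rewrite /laplacian /dirderiv mulr_sumr -sumrMnl -big_split /=.
apply: eq_bigr => i _.
rewrite mderivM mderiv_linmp mderivD mderiv_mulC mderivM mderiv_linmp.
by rewrite !mul_mpolyC; ring.
Qed.

Lemma dirderivC u v p : dirderiv u (dirderiv v p) = dirderiv v (dirderiv u p).
Proof.
rewrite {2}/dirderiv {3}/dirderiv linear_sum; apply: eq_bigr => i _ /=.
by rewrite linearZ /= dirderiv_mderiv.
Qed.

(** Moving [laplacian] past a linear form produces twice a directional derivative; the two such
    terms are mixed second derivatives along [u] and [v], which cancel. Thus rotations preserve
    harmonicity. *)
Lemma laplacian_rotd u v p : laplacian (rotd u v p) = rotd u v (laplacian p).
Proof.
rewrite !rotdE linearB /= !laplacian_linmpM !laplacian_dirderiv dirderivC.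
ring.
Qed.

Lemma homog_mderiv k i p : p \is homog k.+1 -> mderiv i p \is homog k.
Proof.
move=> /dhomogP pk; rewrite /mderiv big_seq; apply: rpred_sum => mm mp.
(* Subtraction of exponents truncates and can be undone only where X_i occurs; where it does not,
   the coefficient vanishes. *)
have [->|mi0] := eqVneq (mm i) 0%N; first by rewrite mul0r scale0r rpred0.
have : mdeg (mnm_add (mnm_sub mm (mnm1 i)) (mnm1 i)) = k.+1.
  by rewrite submK ?lep1mP //; exact: pk.
rewrite mdegD mdeg1 addn1 => -[mk].
by apply: rpredZ; rewrite dhomogX /= mk.
Qed.

Lemma homog0P p : p \is homog 0 -> p = mpolyC m (mcoeff mnm0 p).
Proof.
move=> p0; apply/mpolyP => mm; rewrite mcoeffC.
have [<-|mm0] := eqVneq mm (@mnm0 m); first by rewrite mulr1.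
by rewrite mulr0; apply: (dhomog_nemf_coeff p0); rewrite /= mdeg_eq0.
Qed.

Lemma homog_mderiv0 i p : p \is homog 0 -> mderiv i p = 0.
Proof. by move=> /homog0P ->; rewrite mderivC. Qed.

Lemma homog_linmp u : linmp u \is homog 1.
Proof.
by apply: rpred_sum => i _; apply: rpredZ; rewrite dhomogX /= mdeg1.
Qed.

Lemma homog_dirderiv k v p : p \is homog k.+1 -> dirderiv v p \is homog k.
Proof.
by move=> pk; apply: rpred_sum => i _; apply: rpredZ; apply: homog_mderiv.
Qed.

Lemma homog_rotd k u v p : p \is homog k -> rotd u v p \is homog k.
Proof.
case: k => [/homog0P ->|k pk].
  suff d0 w c : dirderiv w (mpolyC m c) = 0 by rewrite rotdE !d0 !mulr0 subrr rpred0.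
  by rewrite /dirderiv big1 // => i _; rewrite mderivC scaler0.
by rewrite rotdE rpredB // -add1n dhomogM ?homog_linmp ?homog_dirderiv.
Qed.

(** Euler's identity: X_i d_i multiplies a monomial by its exponent in X_i, and the exponents add up
    to the degree. *)
Lemma euler_homog k p : p \is homog k -> \sum_i 'X_i * mderiv i p = p *+ k.
Proof.
move=> /dhomogP pk; rewrite [in LHS](mpolyE p) [in RHS](mpolyE p) -sumrMnl.
under eq_bigr do rewrite linear_sum mulr_sumr.
rewrite exchange_big /= big_seq [RHS]big_seq; apply: eq_bigr => mm mp.
rewrite -(pk _ mp) /= mdegE -sumrMnr; apply: eq_bigr => i _.
rewrite linearZ /= mderivX -!scalerAr scalerA -mpolyXD.
have [->|mi0] := eqVneq (mm i) 0%N; first by rewrite mulr0 scale0r mulr0n.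
rewrite addmC submK ?lep1mP //.
by rewrite mulr_natr scalerMnl.
Qed.

End Derivations.

(** * Harmonic polynomials and rotation invariants *)

Section HarmonicPolynomials.
Context (K : numFieldType) (m : nat).
Implicit Types (p q : mpoly m K) (u v e : 'rV[K]_m) (i j : 'I_m) (k l : nat).

Lemma mpoly_mulrn_eq0 k p : (p *+ k == 0) = (k == 0%N) || (p == 0).
Proof. by rewrite -scaler_nat scaler_eq0 pnatr_eq0. Qed.

Lemma homog_mderiv_eq0 k p :
  p \is homog k.+1 -> (forall i, mderiv i p = 0) -> p = 0.
Proof.
move=> pk dp0; apply/eqP; rewrite -[_ == _]/((k.+1 == 0%N) || (p == 0)).
rewrite -mpoly_mulrn_eq0 -(euler_homog pk) big1 // => i _.
by rewrite dp0 mulr0.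
Qed.

(** For [e] of bilinear square 1, the component of the i-th basis vector orthogonal to [e]. These
    vectors span the complement of [e], so their rotations are the infinitesimal rotations fixing
    [e]. *)
Definition tangent e i : 'rV[K]_m := delta_mx 0 i - e 0 i *: e.

Lemma tangentE e i j : tangent e i 0 j = (i == j)%:R - e 0 i * e 0 j.
Proof. by rewrite !mxE eqxx /= eq_sym. Qed.

Lemma linmp_tangent e i : linmp (tangent e i) = 'X_i - e 0 i *: linmp e.
Proof. by rewrite /tangent linearB linearZ /= linmp_delta. Qed.

Lemma dirderiv_tangent e i p :
  dirderiv (tangent e i) p = mderiv i p - e 0 i *: dirderiv e p.
Proof.
by rewrite /tangent addrC -scaleNr dirderivP dirderiv_delta scaleNr addrC.
Qed.

Lemma dirderiv_linmp u v : dirderiv u (linmp v) = mpolyC m (\sum_i u 0 i * v 0 i).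
Proof.
rewrite rmorph_sum; apply: eq_bigr => i _.
by rewrite mderiv_linmp -mul_mpolyC -rmorphM.
Qed.

(** The linear forms of [u] and [v] have zero derivative along [e]. Hence the derivative along a
    pole inherits invariance under the rotations that fix it. *)
Lemma dirderiv_rotd e u v p :
  \sum_i e 0 i * u 0 i = 0 -> \sum_i e 0 i * v 0 i = 0 ->
  dirderiv e (rotd u v p) = rotd u v (dirderiv e p).
Proof.
move=> eu ev; rewrite !rotdE linearB /= !dirderivM !dirderiv_linmp eu ev mpolyC0.
by rewrite !mul0r !add0r (dirderivC e u) (dirderivC e v).
Qed.

Lemma meval_euler k p e : p \is homog k ->
  meval (e 0) (dirderiv e p) = meval (e 0) p *+ k.
Proof.
move=> pk; rewrite -raddfMn /= -(euler_homog pk) /dirderiv !raddf_sum /=.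
by apply: eq_bigr => i _; rewrite mevalZ mevalM mevalXU.
Qed.

Lemma sum_mderiv_linmpM u (G : 'I_m -> mpoly m K) :
  \sum_j mderiv j (linmp u * G j) =
  \sum_j u 0 j *: G j + linmp u * \sum_j mderiv j (G j).
Proof.
rewrite mulr_sumr -big_split; apply: eq_bigr => j _ /=.
by rewrite mderivM mderiv_linmp mul_mpolyC.
Qed.

(* A harmonic polynomial annihilated by the rotations that fix [e] and
   vanishing at [e] is zero: its derivative along [e] has the same properties
   and a smaller degree; once that derivative is zero, applying the divergence
   to [y_i d_j p = y_j d_i p], where [y] is the component orthogonal to [e],
   gives [(m + k - 3) d_i p = 0]. *)
Lemma zonal_eq0 e k p : (2 < m)%N -> \sum_i e 0 i * e 0 i = 1 ->
  p \is homog k -> laplacian p = 0 ->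
  (forall i j, rotd (tangent e i) (tangent e j) p = 0) ->
  meval (e 0) p = 0 -> p = 0.
Proof.
move=> m2 e1; elim: k p => [|k IH] p pk Lp zp pe.
  by move: pe; rewrite (homog0P pk) mevalC => ->; rewrite mpolyC0.
have te i : \sum_j e 0 j * tangent e i 0 j = 0.
  under eq_bigr do rewrite tangentE mulrBr mulrCA.
  rewrite sumrB -mulr_sumr e1 mulr1 (bigD1 i) //= eqxx mulr1 big1 ?addr0 ?subrr//.
  by move=> j /negPf ji; rewrite eq_sym ji mulr0.
have de0 : dirderiv e p = 0.
  apply: IH.
  - exact: homog_dirderiv.
  - by rewrite laplacian_dirderiv Lp linear0.
  - by move=> i j; rewrite -dirderiv_rotd // zp linear0.
  - by rewrite (meval_euler _ pk) pe mul0rn.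
have tp i : dirderiv (tangent e i) p = mderiv i p.
  by rewrite dirderiv_tangent de0 scaler0 subr0.
apply: (homog_mderiv_eq0 pk) => i.
have : \sum_j mderiv j (linmp (tangent e i) * mderiv j p) =
       \sum_j mderiv j (linmp (tangent e j) * mderiv i p).
  apply: eq_bigr => j _; congr (mderiv j _); apply/eqP.
  by rewrite -subr_eq0 -!tp -rotdE zp.
rewrite sum_mderiv_linmpM -[\sum_j _ *: _]/(dirderiv (tangent e i) p) tp.
rewrite -[\sum_j mderiv j (mderiv j p)]/(laplacian p) Lp mulr0 addr0.
under [RHS]eq_bigr do rewrite mderivM mderiv_linmp linmp_tangent mulrBl.
rewrite big_split /= sumrB (euler_homog (homog_mderiv i pk)).
rewrite [X in _ - X](_ : _ = 0) ?subr0; last first.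
  under eq_bigr do rewrite -scalerAl scalerAr.
  rewrite -mulr_sumr -[\sum_j _ *: _]/(dirderiv e (mderiv i p)).
  by rewrite dirderiv_mderiv de0 linear0 mulr0.
under eq_bigr do rewrite mul_mpolyC tangentE eqxx.
rewrite -scaler_suml sumrB e1 sumr_const card_ord scalerBl scale1r scaler_nat.
(* Here [p] has degree k + 1, so the factor m + deg p - 3 is m + k - 2, written as a successor to be
   visibly nonzero. *)
move=> H; apply/eqP; have : mderiv i p *+ ((m - 3) + k).+1 == 0.
  move: H; have -> (x : mpoly m K) : x *+ m = x *+ (m - 3) + x *+ 3.
    by rewrite -mulrnDr subnK.
  move=> /eqP.
  rewrite -subr_eq0 => /eqP H; apply/eqP; rewrite -[RHS]oppr0 -H.
  ring.
by rewrite mpoly_mulrn_eq0.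
Qed.

Definition sqnormp : mpoly m K := \sum_i 'X_i * 'X_i.

Lemma meval_sqnormp (x : 'I_m -> K) : meval x sqnormp = \sum_i x i * x i.
Proof. by rewrite rmorph_sum; apply: eq_bigr => i _; rewrite rmorphM /= mevalXU. Qed.

(** Since [sqnormp] is 1 on the sphere, this expresses a partial derivative there through rotations
    of [p] and [p] itself; Euler's identity supplies the radial part. *)
Lemma sqnormp_mderiv k p i : p \is homog k ->
  sqnormp * mderiv i p =
  \sum_j 'X_j * rotd (delta_mx 0 j) (delta_mx 0 i) p + 'X_i * (p *+ k).
Proof.
move=> pk; rewrite -(euler_homog pk) mulr_sumr -big_split /sqnormp mulr_suml /=.
by apply: eq_bigr => j _; rewrite rotd_delta; ring.
Qed.

(** Taking divergences in the invariance relation gives X_i Lp = (m + deg p - 2) d_i p, with L the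
    Laplacian, and Euler's identity then makes |x|^2 Lp a positive multiple of [p]. So on the sphere
    [p] is proportional to Lp, which is again invariant and has degree two less; in degree 1, Lp =
    0. *)
Lemma rotation_invariant_const k p : (1 < m)%N -> p \is homog k ->
  (forall i j, 'X_i * mderiv j p = 'X_j * mderiv i p) ->
  exists c, forall x : 'I_m -> K, \sum_i x i * x i = 1 -> meval x p = c.
Proof.
move=> m1; elim/ltn_ind: k p => -[|k] IH p pk pr.
  by exists (mcoeff mnm0 p) => x _; rewrite {1}(homog0P pk) mevalC.
have Lp i : 'X_i * laplacian p = mderiv i p *+ ((m - 2) + k).+1.
  have : \sum_j mderiv j (linmp (delta_mx 0 i) * mderiv j p) =
         \sum_j mderiv j (linmp (delta_mx 0 j) * mderiv i p).
    by apply: eq_bigr => j _; rewrite !linmp_delta pr.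
  rewrite sum_mderiv_linmpM -[\sum_j _ *: _]/(dirderiv (delta_mx 0 i) p).
  rewrite dirderiv_delta linmp_delta -[\sum_j mderiv j _]/(laplacian p).
  under [X in _ = X -> _]eq_bigr do rewrite mderivM mderiv_linmp linmp_delta.
  rewrite big_split /= (euler_homog (homog_mderiv i pk)).
  under eq_bigr do rewrite mul_mpolyC mxE !eqxx scale1r.
  rewrite sumr_const card_ord.
  have -> (x : mpoly m K) : x *+ m = x *+ (m - 2) + x *+ 2.
    by rewrite -mulrnDr subnK.
  move=> H.
  apply: (addrI (mderiv i p)); rewrite H.
  ring.
have Lpp : sqnormp * laplacian p = p *+ k.+1 *+ ((m - 2) + k).+1.
  rewrite /sqnormp mulr_suml -(euler_homog pk) -sumrMnl.
  by apply: eq_bigr => i _; rewrite -mulrA Lp mulrnAr.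
have cK : (k.+1 * (m - 2 + k).+1)%:R != 0 :> K by rewrite pnatr_eq0.
have fromL c : (forall x : 'I_m -> K, \sum_i x i * x i = 1 ->
      meval x (laplacian p) = c) -> exists c, forall x : 'I_m -> K,
      \sum_i x i * x i = 1 -> meval x p = c.
  move=> Lc; exists (c / (k.+1 * (m - 2 + k).+1)%:R) => x x1.
  apply: (canRL (mulfK cK)); rewrite -(Lc x x1) mulr_natr mulrnA -!mevalMn.
  by rewrite -Lpp mevalM meval_sqnormp x1 mul1r.
case: k IH pk {Lp Lpp cK} fromL => [|k] IH pk fromL.
  apply: (fromL 0) => x _; rewrite /laplacian big1 ?meval0 // => i _.
  by rewrite (homog_mderiv0 _ (homog_mderiv i pk)).
have [] := IH k _ (laplacian p).
- by rewrite ltnS leqnSn.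
- by apply: rpred_sum => i _; do 2 apply: homog_mderiv.
- move=> i j; apply/eqP; rewrite -subr_eq0 -rotd_delta -laplacian_rotd.
  by rewrite rotd_delta pr subrr linear0.
- by move=> c; apply: fromL.
Qed.

(** Polynomial form of Green's identity on the sphere: the double sum of rotations has integral
    zero. The term in 2 k stands on the right to avoid a subtraction of naturals. *)
Lemma homogM_rotd k l p q : p \is homog k -> laplacian p = 0 -> q \is homog l ->
  \sum_i \sum_j rotd (delta_mx 0 i) (delta_mx 0 j) ('X_i * (mderiv j p * q))
    + (p * q) *+ (k * (m + k + l)) =
  (p * q) *+ k.*2 + sqnormp * \sum_j (mderiv j p * mderiv j q).
Proof.
move=> pk Lp ql.
(* A rotation is a difference of two terms; [E1] sums the terms X_i d_j and [E2] the terms X_j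
   d_i. *)
have E1 : \sum_i \sum_j 'X_i * mderiv j ('X_i * (mderiv j p * q)) =
    (p * q) *+ k + sqnormp * \sum_j (mderiv j p * mderiv j q).
  have -> : \sum_j (mderiv j p * mderiv j q) = \sum_j mderiv j (mderiv j p * q).
    under [RHS]eq_bigr do rewrite mderivM.
    rewrite big_split /= -mulr_suml -[\sum_j mderiv j (mderiv j p)]/(laplacian p).
    by rewrite Lp mul0r add0r.
  rewrite /sqnormp mulr_suml -mulrnAl -(euler_homog pk) mulr_suml -big_split /=.
  apply: eq_bigr => i _; rewrite -mulr_sumr -[in LHS]linmp_delta.
  rewrite sum_mderiv_linmpM linmp_delta mulrDr !mulrA; congr (_ + _).
  rewrite (bigD1 i) //= mxE !eqxx scale1r big1 ?addr0 ?mulrA // => j /negPf ji.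
  by rewrite mxE ji andbF scale0r.
have E2 : \sum_i \sum_j 'X_j * mderiv i ('X_i * (mderiv j p * q))
    + (p * q) *+ k = (p * q) *+ (k * (m + k + l)).
  rewrite exchange_big /= mulrnA -mulrnAl -(euler_homog pk).
  rewrite mulr_suml -big_split -sumrMnl /=; apply: eq_bigr => j _.
  rewrite -mulr_sumr -!mulrA -mulrDr -mulrnAr; congr ('X_j * _).
  under eq_bigr do rewrite mderivM mderivXE eqxx mul1r.
  rewrite big_split /= sumr_const card_ord -addrA !mulrnDr -addrA; congr (_ + _).
  case: k pk {E1} => [|k] pk.
    rewrite homog_mderiv0 // mul0r !mul0rn !addr0 big1 // => i _.
    by rewrite linear0 mulr0.
  rewrite (euler_homog (dhomogM (homog_mderiv j pk) ql)).
  by rewrite mulrnDr mulrS; ring.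
rewrite -E2 -addnn mulrnDr [in RHS]addrAC -E1 addrA; congr (_ + _).
rewrite -big_split; apply: eq_bigr => i _; rewrite -big_split.
by apply: eq_bigr => j _; rewrite /= rotd_delta subrK.
Qed.

(** A representation contracted with its dual is invariant: exchanging the two indices makes the
    double sums cancel. The intended [b] and [q] are a basis and its conjugated dual basis. *)
Lemma rotd_pairing_eq0 (N : nat) (b q : 'I_N -> mpoly m K)
    (A B : 'I_N -> 'I_N -> K) u v :
  (forall s, rotd u v (b s) = \sum_t A s t *: b t) ->
  (forall s, rotd u v (q s) = \sum_t B s t *: q t) ->
  (forall s t, A s t = - B t s) -> rotd u v (\sum_s b s * q s) = 0.
Proof.
move=> bA qB AB; rewrite linear_sum /=.
under eq_bigr do rewrite rotdM bA qB mulr_suml mulr_sumr.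
rewrite big_split /= [X in _ + X]exchange_big -big_split big1 // => s _ /=.
rewrite -big_split big1 // => t _ /=.
by rewrite AB -scalerAl -scalerAr scaleNr addNr.
Qed.

(** The counterpart of [harmonics] before restriction to the sphere, where derivatives are
    available. *)
Definition solidharm k p := p \is homog k /\ laplacian p = 0.

Lemma solidharm0 k : solidharm k 0.
Proof. by split; [exact: rpred0|exact: linear0]. Qed.

Lemma solidharmZ k c p : solidharm k p -> solidharm k (c *: p).
Proof.
by move=> [pk Lp]; split; [rewrite rpredZ|rewrite linearZ /= Lp scaler0].
Qed.

Lemma solidharmD k p q : solidharm k p -> solidharm k q -> solidharm k (p + q).
Proof.
move=> [pk Lp] [qk Lq]; split; first by rewrite rpredD.
by rewrite linearD /= Lp Lq addr0.
Qed.

Lemma solidharmB k p q : solidharm k p -> solidharm k q -> solidharm k (p - q).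
Proof.
move=> [pk Lp] [qk Lq]; split; first by rewrite rpredB.
by rewrite linearB /= Lp Lq subrr.
Qed.

Lemma solidharm_sum k (I : Type) (s : seq I) (P : pred I) (F : I -> mpoly m K) :
  (forall a, solidharm k (F a)) -> solidharm k (\sum_(a <- s | P a) F a).
Proof.
move=> VF; apply: (big_ind (solidharm k)) => //; first exact: solidharm0.
by move=> *; exact: solidharmD.
Qed.

Lemma solidharm_rotd k u v p : solidharm k p -> solidharm k (rotd u v p).
Proof.
move=> [pk Lp]; split; first exact: homog_rotd.
by rewrite laplacian_rotd Lp linear0.
Qed.

End HarmonicPolynomials.

(** * Integration on the sphere *)

Section SphereTopology.
Context (R : realType) (n : nat).
Implicit Types (x : sphere R n) (Q : 'M[R]_n.+1).

Lemma spoint_dotp x : dotp (spoint x) (spoint x) = 1.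
Proof. by have := set_valP x. Qed.

Lemma spoint_coord_le1 x i : `|spoint x 0 i| <= 1.
Proof.
rewrite -(@ler_pXn2r _ 2) ?nnegrE // expr1n -normrX ger0_norm ?sqr_ge0 //.
rewrite -(spoint_dotp x) /dotp (bigD1 i) //= expr2 lerDl sumr_ge0 // => j _.
by rewrite -expr2 sqr_ge0.
Qed.

Lemma spoint_continuous : continuous (@spoint R n).
Proof.
exact: (@initial_continuous (sphere R n) 'rV[R]_n.+1 (@spoint R n)).
Qed.

Lemma spoint_coord_continuous i : continuous (fun x : sphere R n => spoint x 0 i).
Proof.
move=> x.
apply: (@continuous_comp _ _ _ (@spoint R n) (fun M : 'rV[R]_n.+1 => M 0 i)).
  exact: spoint_continuous.
exact: coord_continuous.
Qed.

Lemma open_measurable_sphere (A : set (sphere R n)) : open A -> measurable A.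
Proof. by move=> oA; apply: sub_sigma_algebra. Qed.

Lemma continuous_measurable_sphere (g : sphere R n -> R) :
  continuous g -> measurable_fun setT g.
Proof.
move=> /continuousP gc; apply: (measurability _ (RGenOpens.measurableE R)).
move=> _ [_ [a [b ->]] <-]; rewrite setTI; apply: open_measurable_sphere.
by apply: gc; exact: interval_open.
Qed.

Fact rotate_subproof Q (hQ : Q *m Q^T = 1%:M) x :
  spoint x *m Q \in [set y : 'rV[R]_n.+1 | dotp y y = 1].
Proof.
apply/mem_set => /=; have dotpE (y : 'rV[R]_n.+1) : dotp y y = (y *m y^T) 0 0.
  by rewrite mxE; apply: eq_bigr => i _; rewrite mxE.
by rewrite dotpE trmx_mul mulmxA -(mulmxA _ Q) hQ mulmx1 -dotpE spoint_dotp.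
Qed.

Definition rotate Q (hQ : Q *m Q^T = 1%:M) x : sphere R n :=
  SigSub (rotate_subproof hQ x).

Lemma spoint_rotate Q (hQ : Q *m Q^T = 1%:M) x :
  spoint (rotate hQ x) = spoint x *m Q.
Proof. by []. Qed.

Lemma spoint_inj : injective (@spoint R n).
Proof. by move=> x y; exact: val_inj. Qed.

Lemma rotate_continuous Q (hQ : Q *m Q^T = 1%:M) : continuous (rotate hQ).
Proof.
apply: continuous_comp_initial => x.
have -> : set_val \o rotate hQ = fun y => spoint y *m Q by [].
move=> A [P Px sPA].
have FF : Filter (nbhs x) by exact: nbhs_filter.
have cQ j : continuous (fun y : sphere R n => (spoint y *m Q) 0 j).
  under eq_fun do rewrite mxE.
  apply: continuous_big => [|k _ y]; first exact: add_continuous.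
  exact: (cvgM (@spoint_coord_continuous k y) (cvg_cst (Q k j))).
(* Neighbourhoods of a row vector are generated by products of neighbourhoods of its entries, so
   finitely many coordinate conditions suffice. *)
have : \forall y \near x, forall i j, P i j ((spoint y *m Q) i j).
  apply: (@filter_forall _ _ (fun i y => forall j, P i j ((spoint y *m Q) i j))
     _ FF) => i.
  apply: (@filter_forall _ _ (fun j y => P i j ((spoint y *m Q) i j)) _ FF) => j.
  by have := Px i j; rewrite (ord1 i); exact: cQ.
by apply: filterS => y Py; apply: sPA => i j; exact: Py.
Qed.

Lemma rotate_measurable Q (hQ : Q *m Q^T = 1%:M) :
  measurable_fun setT (rotate hQ).
Proof.
apply: (@measurability _ _ _ _ _ _ (@open (sphere R n))) => //.
move=> _ [A oA <-]; rewrite setTI; apply: open_measurable_sphere.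
by have /continuousP := @rotate_continuous Q hQ; apply.
Qed.

End SphereTopology.

Section SphereIntegral.
Context (R : realType) (n : nat) (S : probability (sphere R n) R).
Implicit Types (g h : sphere R n -> R) (f : sphere R n -> R[i]).

(** Bounded measurable functions form an algebra and are integrable for a probability measure, which
    discharges the integrability conditions below. *)
Definition bmr g := measurable_fun setT g /\ exists C, forall x, `|g x| <= C.

Lemma bmr_integrable g : bmr g -> S.-integrable setT (EFin \o g).
Proof.
move=> [mg [C gC]]; apply: measurable_bounded_integrable => //.
  by rewrite (le_lt_trans (probability_le1 _ _)) // ltry.
exists C; split; first exact: num_real.
by move=> M CM x _; apply: (le_trans (gC x)); exact: ltW.
Qed.

Lemma bmr_cst c : bmr (fun=> c).
Proof. by split; [exact: measurable_cst|exists `|c|]. Qed.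

Lemma bmrD g h : bmr g -> bmr h -> bmr (fun x => g x + h x).
Proof.
move=> [mg [C gC]] [mh [D hD]]; split; first exact: measurable_funD.
by exists (C + D) => x; rewrite (le_trans (ler_normD _ _)) // lerD.
Qed.

Lemma bmrM g h : bmr g -> bmr h -> bmr (fun x => g x * h x).
Proof.
move=> [mg [C gC]] [mh [D hD]]; split; first exact: measurable_funM.
by exists (C * D) => x; rewrite normrM ler_pM.
Qed.

Lemma bmrN g : bmr g -> bmr (fun x => - g x).
Proof.
move=> /(bmrM (bmr_cst (-1))); congr bmr.
by apply/funext => x; rewrite mulN1r.
Qed.

Lemma bmrB g h : bmr g -> bmr h -> bmr (fun x => g x - h x).
Proof. by move=> bg /bmrN; exact: bmrD. Qed.

(** Invariance is given for images of sets. The preimage of a set under [rotate hQ] is its image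
    under [Q^T], so the pushforward of [S] is [S]. *)
Lemma Rintegral_rotate (S_uniform : uniform_sphere S) (Q : 'M[R]_n.+1)
    (hQ : Q *m Q^T = 1%:M) g : bmr g ->
  (\int[S]_x g (rotate hQ x) = \int[S]_x g x)%R.
Proof.
move=> bg; have mr := rotate_measurable hQ.
have hQ' : Q^T *m (Q^T)^T = 1%:M by rewrite trmxK; exact: mulmx1C.
have SE A : measurable A -> pushforward S (rotate hQ) A = S A.
  move=> mA; rewrite -(S_uniform _ hQ' A mA) /pushforward; congr (S _).
  apply/seteqP; split => x /=.
    by move=> Ax; exists (rotate hQ x) => //; rewrite spoint_rotate -mulmxA hQ mulmx1.
  move=> [y Ay E]; suff -> : rotate hQ x = y by [].
  by apply: spoint_inj; rewrite spoint_rotate E -mulmxA (mulmx1C hQ) mulmx1.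
rewrite /Rintegral; congr fine.
rewrite [RHS](eq_measure_integral (pushforward S (rotate hQ))); last first.
  by move=> A mA _; exact/esym/SE.
rewrite integral_pushforward //.
  by apply/measurable_EFinP; case: bg.
apply: bmr_integrable; case: bg => mg [C gC]; split; last by exists C => x.
exact: measurableT_comp.
Qed.

End SphereIntegral.

(** * Complex integrals and the Hermitian inner product *)

Section ComplexIntegral.
Context (R : realType) (n : nat) (S : probability (sphere R n) R).
Implicit Types (f g h : sphere R n -> R[i]) (c z : R[i]).

Lemma ReD (x y : R[i]) :
  complex.Re (x + y) = complex.Re x + complex.Re y.
Proof. by case: x; case: y. Qed.

Lemma ImD (x y : R[i]) :
  complex.Im (x + y) = complex.Im x + complex.Im y.
Proof. by case: x; case: y. Qed.

Lemma ReM (x y : R[i]) :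
  complex.Re (x * y) = complex.Re x * complex.Re y - complex.Im x * complex.Im y.
Proof. by case: x; case: y. Qed.

Lemma ImM (x y : R[i]) :
  complex.Im (x * y) = complex.Re x * complex.Im y + complex.Im x * complex.Re y.
Proof. by case: x; case: y. Qed.

Lemma normcE2 (z : R[i]) :
  normc z = Num.sqrt (complex.Re z ^+ 2 + complex.Im z ^+ 2).
Proof. by case: z. Qed.

Lemma normcr_norm (z : R[i]) : (normc z)%:C%C = `|z|.
Proof. by []. Qed.

Lemma normc_ge0 (z : R[i]) : 0 <= normc z.
Proof. by rewrite normcE2 sqrtr_ge0. Qed.

Lemma Re_le_normc (z : R[i]) : `|complex.Re z| <= normc z.
Proof. by rewrite normcE2 -sqrtr_sqr ler_wsqrtr // lerDl sqr_ge0. Qed.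

Lemma Im_le_normc (z : R[i]) : `|complex.Im z| <= normc z.
Proof. by rewrite normcE2 -sqrtr_sqr ler_wsqrtr // lerDr sqr_ge0. Qed.

Definition bm f :=
  bmr (fun x => complex.Re (f x)) /\ bmr (fun x => complex.Im (f x)).

Lemma bm_cst c : bm (fun=> c).
Proof. by split; exact: bmr_cst. Qed.

Lemma bmD f g : bm f -> bm g -> bm (fun x => f x + g x).
Proof.
move=> [fr fi] [gr gi]; split.
  by have := bmrD fr gr; congr bmr; apply/funext => x; rewrite ReD.
by have := bmrD fi gi; congr bmr; apply/funext => x; rewrite ImD.
Qed.

Lemma bmM f g : bm f -> bm g -> bm (fun x => f x * g x).
Proof.
move=> [fr fi] [gr gi]; split.
  by have := bmrB (bmrM fr gr) (bmrM fi gi); congr bmr; apply/funext => x; rewrite ReM.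
by have := bmrD (bmrM fr gi) (bmrM fi gr); congr bmr; apply/funext => x; rewrite ImM.
Qed.

Lemma bmZ c f : bm f -> bm (fun x => c * f x).
Proof. by apply: bmM; exact: bm_cst. Qed.

Lemma bmN f : bm f -> bm (fun x => - f x).
Proof.
by move=> /(bmZ (-1)); congr bm; apply/funext => x; rewrite mulN1r.
Qed.

Lemma bmB f g : bm f -> bm g -> bm (fun x => f x - g x).
Proof. by move=> bf /bmN; exact: bmD. Qed.

Lemma bmC f : bm f -> bm (fun x => conjc (f x)).
Proof.
move=> [fr fi]; split.
  by move: fr; congr bmr; apply/funext => x; case: (f x).
by move/bmrN: fi; congr bmr; apply/funext => x; case: (f x).
Qed.

Lemma bm_sum (T : Type) (s : seq T) (P : pred T) (F : T -> sphere R n -> R[i]) :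
  (forall i, P i -> bm (F i)) -> bm (fun x => \sum_(i <- s | P i) F i x).
Proof.
move=> bF; elim: s => [|i s IH].
  by move: (bm_cst 0); congr bm; apply/funext => x; rewrite big_nil.
have -> : (fun x => \sum_(j <- i :: s | P j) F j x) =
    (fun x => (if P i then F i x else 0) + \sum_(j <- s | P j) F j x).
  by apply/funext => x; rewrite big_cons; case: ifP; rewrite ?add0r.
apply: bmD => //; case Pi: (P i); [exact: bF|exact: bm_cst].
Qed.

Lemma bm_bounded f : bm f -> exists2 C : R, 0 < C & forall x, normc (f x) <= C.
Proof.
move=> [[_ [C fC]] [_ [D fD]]]; exists (`|C| + `|D| + 1).
  by rewrite ltr_wpDl // addr_ge0.
move=> x; rewrite normcE2 -[leRHS]ger0_norm ?addr_ge0 // -sqrtr_sqr ler_wsqrtr //.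
have {fC}fC := le_trans (fC x) (ler_norm _).
have {fD}fD := le_trans (fD x) (ler_norm _).
rewrite -[complex.Re _ ^+ 2]real_normK ?num_real //.
rewrite -[complex.Im _ ^+ 2]real_normK ?num_real //.
have := normr_ge0 (complex.Re (f x)); have := normr_ge0 (complex.Im (f x)).
by nra.
Qed.

Definition cint f : R[i] :=
  ((\int[S]_x complex.Re (f x))%R +i* (\int[S]_x complex.Im (f x))%R)%C.

Lemma l2innerE f g : l2inner S f g = cint (fun x => f x * conjc (g x)).
Proof. by []. Qed.

Lemma cintD f g : bm f -> bm g -> cint (fun x => f x + g x) = cint f + cint g.
Proof.
move=> [fr fi] [gr gi]; apply/eqP; rewrite eq_complex /=.
rewrite -!RintegralD //; [|exact: bmr_integrable..].
by apply/andP; split; apply/eqP; congr Rintegral; apply/funext => x;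
  rewrite ?ReD ?ImD.
Qed.

Lemma cintZ c f : bm f -> cint (fun x => c * f x) = c * cint f.
Proof.
move=> [fr fi]; have bc := @bmr_cst R n; apply/eqP; rewrite eq_complex.
rewrite ReM ImM /= -!RintegralZl //; [|exact: bmr_integrable..].
rewrite -RintegralB //; [|by apply: bmr_integrable; exact: bmrM..].
rewrite -RintegralD //; [|by apply: bmr_integrable; exact: bmrM..].
by apply/andP; split; apply/eqP; congr Rintegral; apply/funext => x;
  rewrite ?ReM ?ImM.
Qed.

Lemma cint_conj f : bm f -> cint (fun x => conjc (f x)) = conjc (cint f).
Proof.
move=> [fr fi]; apply/eqP; rewrite eq_complex /=; apply/andP; split; apply/eqP.
  by congr Rintegral; apply/funext => x; case: (f x).
rewrite -mulN1r -RintegralZl //; last exact: bmr_integrable.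
by congr Rintegral; apply/funext => x; rewrite mulN1r; case: (f x).
Qed.

Lemma cint_cst c : cint (fun=> c) = c.
Proof.
have p1 : fine (S setT) = 1 by rewrite probability_setT.
apply/eqP; rewrite eq_complex /= !Rintegral_cst // p1 !mulr1.
by apply/andP; split.
Qed.

Lemma cint_rotate (S_uniform : uniform_sphere S) (Q : 'M[R]_n.+1)
    (hQ : Q *m Q^T = 1%:M) f : bm f ->
  cint (fun x => f (rotate hQ x)) = cint f.
Proof.
move=> [fr fi]; rewrite /cint.
by rewrite (Rintegral_rotate S_uniform hQ fr) (Rintegral_rotate S_uniform hQ fi).
Qed.

Lemma l2innerC f g : bm f -> bm g -> l2inner S g f = conjc (l2inner S f g).
Proof.
move=> bf bg; rewrite !l2innerE -cint_conj; last by apply: bmM => //; exact: bmC.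
by congr cint; apply/funext => x; rewrite rmorphM /= conjcK mulrC.
Qed.

Lemma l2innerDl f g h : bm f -> bm g -> bm h ->
  l2inner S (fun x => f x + g x) h = l2inner S f h + l2inner S g h.
Proof.
move=> bf bg bh; rewrite !l2innerE -cintD; try by apply: bmM => //; exact: bmC.
by congr cint; apply/funext => x; rewrite mulrDl.
Qed.

Lemma l2innerZl c f h : bm f -> bm h ->
  l2inner S (fun x => c * f x) h = c * l2inner S f h.
Proof.
move=> bf bh; rewrite !l2innerE -cintZ; last by apply: bmM => //; exact: bmC.
by congr cint; apply/funext => x; rewrite mulrA.
Qed.

Lemma l2innerBl f g h : bm f -> bm g -> bm h ->
  l2inner S (fun x => f x - g x) h = l2inner S f h - l2inner S g h.
Proof.
move=> bf bg bh; rewrite l2innerDl //; last exact: bmN.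
congr (_ + _); rewrite -mulN1r -l2innerZl //.
by congr l2inner; apply/funext => x; rewrite mulN1r.
Qed.

Lemma l2inner_suml (T : Type) (s : seq T) (P : pred T)
    (F : T -> sphere R n -> R[i]) h :
  (forall i, P i -> bm (F i)) -> bm h ->
  l2inner S (fun x => \sum_(i <- s | P i) F i x) h =
  \sum_(i <- s | P i) l2inner S (F i) h.
Proof.
move=> bF bh; elim: s => [|i s IH].
  rewrite big_nil l2innerE -[RHS](cint_cst 0); congr cint.
  by apply/funext => x; rewrite big_nil mul0r.
rewrite big_cons -IH; case Pi: (P i).
  rewrite -l2innerDl //; [|exact: bF|exact: bm_sum].
  by congr l2inner; apply/funext => x; rewrite big_cons Pi.
by congr l2inner; apply/funext => x; rewrite big_cons Pi.
Qed.

Lemma l2innerDr f g h : bm f -> bm g -> bm h ->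
  l2inner S h (fun x => f x + g x) = l2inner S h f + l2inner S h g.
Proof.
move=> bf bg bh; rewrite (l2innerC (bmD bf bg) bh) l2innerDl // rmorphD.
by rewrite (l2innerC bf bh) (l2innerC bg bh).
Qed.

Lemma l2innerZr c f h : bm f -> bm h ->
  l2inner S h (fun x => c * f x) = conjc c * l2inner S h f.
Proof.
move=> bf bh; rewrite (l2innerC (bmZ c bf) bh) l2innerZl // rmorphM.
by rewrite (l2innerC bf bh).
Qed.

Lemma l2innerBr f g h : bm f -> bm g -> bm h ->
  l2inner S h (fun x => f x - g x) = l2inner S h f - l2inner S h g.
Proof.
move=> bf bg bh; rewrite (l2innerC (bmB bf bg) bh) l2innerBl // rmorphB.
by rewrite (l2innerC bf bh) (l2innerC bg bh).
Qed.

Lemma l2inner_sumr (T : Type) (s : seq T) (P : pred T)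
    (F : T -> sphere R n -> R[i]) h :
  (forall i, P i -> bm (F i)) -> bm h ->
  l2inner S h (fun x => \sum_(i <- s | P i) F i x) =
  \sum_(i <- s | P i) l2inner S h (F i).
Proof.
move=> bF bh; rewrite (l2innerC (bm_sum _ bF) bh) l2inner_suml // rmorph_sum.
by apply: eq_bigr => i Pi; rewrite (l2innerC (bF i Pi) bh).
Qed.

(** Real-valued version of [l2norm]; [l2normE] identifies the two on bounded measurable
    functions. *)
Definition L2 f : R := Num.sqrt (complex.Re (l2inner S f f)).

Lemma L2_ge0 f : 0 <= L2 f.
Proof. exact: sqrtr_ge0. Qed.

Lemma Re_mul_conj (z : R[i]) : complex.Re (z * conjc z) = normc z ^+ 2.
Proof.
by rewrite normcE2 sqr_sqrtr ?addr_ge0 ?sqr_ge0 //; case: z => a b /=; ring.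
Qed.

Lemma l2inner_self f : bm f -> l2inner S f f = (L2 f ^+ 2)%:C%C.
Proof.
move=> bf; rewrite /L2 sqr_sqrtr; last first.
  by apply: Rintegral_ge0 => x _; rewrite Re_mul_conj sqr_ge0.
apply/eqP; rewrite eq_complex eqxx /=; apply/eqP.
rewrite (_ : (fun _ => _) = cst 0) ?Rintegral_cst ?mul0r //.
by apply/funext => x; rewrite ImM; case: (f x) => a b /=; ring.
Qed.

Lemma mul_conjc (z : R[i]) : z * conjc z = (normc z ^+ 2)%:C%C.
Proof. by rewrite rmorphXn /= normcr_norm sqr_normc. Qed.

(** The expression is the squared norm of a f - t <f, g> g. *)
Lemma L2_combination (a t : R) f g : bm f -> bm g ->
  0 <= a ^+ 2 * L2 f ^+ 2 - 2 * a * t * normc (l2inner S f g) ^+ 2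
       + t ^+ 2 * normc (l2inner S f g) ^+ 2 * L2 g ^+ 2.
Proof.
move=> bf bg; set N := normc _; pose z := l2inner S f g.
have baf := bmZ a%:C%C bf; have bzg := bmZ (- t%:C%C * z) bg.
have baz := bmD baf bzg.
suff -> : a ^+ 2 * L2 f ^+ 2 - 2 * a * t * N ^+ 2 + t ^+ 2 * N ^+ 2 * L2 g ^+ 2 =
    L2 (fun x => a%:C%C * f x + (- t%:C%C * z) * g x) ^+ 2 by exact: sqr_ge0.
apply: complexI; rewrite -l2inner_self // l2innerDl // !l2innerDr //.
rewrite !l2innerZl // !l2innerZr // (l2innerC bf bg) !l2inner_self // -/z.
have -> : conjc (- t%:C%C * z) = - t%:C%C * conjc z.
  by rewrite rmorphM rmorphN; congr (- _ * _); exact: conjc_real.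
rewrite !conjc_real.
transitivity (a%:C%C ^+ 2 * (L2 f ^+ 2)%:C%C - 2 * a%:C%C * t%:C%C * (z * conjc z)
    + t%:C%C ^+ 2 * (z * conjc z) * (L2 g ^+ 2)%:C%C); last by ring.
by rewrite mul_conjc -/N; ring.
Qed.

Lemma l2inner_cauchy f g : bm f -> bm g ->
  normc (l2inner S f g) <= L2 f * L2 g.
Proof.
move=> bf bg; have := @L2_combination _ _ f g bf bg.
move: (normc_ge0 (l2inner S f g)) (L2_ge0 f) (L2_ge0 g).
move: (normc _) (L2 f) (L2 g) => N A B N0 A0 B0 /= quad.
have [B_0|Bn0] := eqVneq B 0.
  rewrite B_0 mulr0; have [->//|Nn0] := eqVneq N 0.
  have N2 : 0 < N ^+ 2 by rewrite exprn_gt0 // lt_def Nn0.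
  (* If [g] has norm 0 the form is affine in t, and this t gives it the value -1. *)
  have := quad 1 ((A ^+ 2 + 1) / (2 * N ^+ 2)); rewrite B_0.
  have -> : 1 ^+ 2 * A ^+ 2 - 2 * 1 * ((A ^+ 2 + 1) / (2 * N ^+ 2)) * N ^+ 2 +
      ((A ^+ 2 + 1) / (2 * N ^+ 2)) ^+ 2 * N ^+ 2 * 0 ^+ 2 = -1.
    by field; rewrite Nn0.
  by rewrite oppr_ge0 ler10.
have B2 : 0 < B ^+ 2 by rewrite exprn_gt0 // lt_def Bn0.
have := quad (B ^+ 2) 1.
have -> : B ^+ 2 ^+ 2 * A ^+ 2 - 2 * B ^+ 2 * 1 * N ^+ 2 + 1 ^+ 2 * N ^+ 2 * B ^+ 2 =
    B ^+ 2 * ((A * B) ^+ 2 - N ^+ 2) by ring.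
by rewrite pmulr_rge0 // subr_ge0 ler_pXn2r // nnegrE mulr_ge0.
Qed.

Lemma L2_le_bound f C : bm f -> 0 <= C -> (forall x, normc (f x) <= C) -> L2 f <= C.
Proof.
move=> bf C0 fC; rewrite -[leRHS]ger0_norm // -sqrtr_sqr ler_wsqrtr //.
have -> : C ^+ 2 = complex.Re (cint (fun=> (C ^+ 2)%:C%C)) by rewrite cint_cst.
have [br _] := bmM bf (bmC bf).
apply: le_Rintegral => //.
- exact: bmr_integrable.
- by apply: bmr_integrable; exact: bmr_cst.
- by move=> x _ /=; rewrite Re_mul_conj ler_pXn2r ?nnegrE ?normc_ge0.
Qed.

Lemma l2normE f : bm f -> l2norm S f = (L2 f)%:E.
Proof.
move=> bf; rewrite /l2norm unlock /L2 -powR12_sqrt; last first.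
  by apply: Rintegral_ge0 => x _; rewrite Re_mul_conj sqr_ge0.
have [br _] := bmM bf (bmC bf).
rewrite -poweR_EFin; congr poweR.
rewrite /l2inner /= /Rintegral fineK; last first.
  by apply: integrable_fin_num => //; exact: bmr_integrable.
apply: eq_integral => x _; rewrite ger0_norm ?normc_ge0 //.
by rewrite powR_mulrn ?normc_ge0 // Re_mul_conj.
Qed.

(** A term [s m] closer to [P] than half the norm of [P] has at least half that norm. The triangle
    inequality is Minkowski's for the moduli of [P - s m] and [s m], whose sum dominates the modulus
    of [P]. *)
Lemma l2norm_approx P (s : nat -> sphere R n -> R[i]) :
  in_L2 S P -> (forall m, bm (s m)) ->
  l2norm S (fun x => P x - s m x) @[m --> \oo] --> 0%E ->
  (0 < l2norm S P)%E -> exists m, (l2norm S P <= (2 * L2 (s m))%:E)%E.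
Proof.
move=> [mr mi Pfin] bs Ps P0.
have Pfn : l2norm S P \is a fin_num by rewrite ge0_fin_numE // ltW.
have mnormc f : measurable_fun setT (fun x => complex.Re (f x)) ->
    measurable_fun setT (fun x => complex.Im (f x)) ->
    measurable_fun setT (fun x => normc (f x)).
  move=> fr fi; under eq_fun do rewrite normcE2 -powR12_sqrt ?addr_ge0 ?sqr_ge0 //.
  apply: (measurableT_comp (measurable_powR _)).
  by apply: measurable_funD; exact: measurable_funX.
have half0 : (0 < l2norm S P * (2^-1)%:E)%E by rewrite mule_gt0 // lte_fin invr_gt0.
have : \forall m \near \oo,
    (l2norm S (fun x => P x - s m x)%R < l2norm S P * (2^-1)%:E)%E.
  exact: (Ps _ (open_ereal_lt' half0)).
move=> /filter_ex[m Pm]; exists m.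
have msr f : bm f -> measurable_fun setT (fun x => normc (f x)).
  by move=> [[fr _] [fi _]]; exact: mnormc.
have mPs : measurable_fun setT (fun x => normc (P x - s m x)).
  have [[sr _] [si _]] := bmN (bs m).
  apply: mnormc.
    by under eq_fun do rewrite ReD; exact: measurable_funD.
  by under eq_fun do rewrite ImD; exact: measurable_funD.
have mpow (g : sphere R n -> R) : measurable_fun setT g ->
    measurable_fun setT (fun x => `|(g x)%:E| `^ 2)%E.
  move=> mg; apply: (@measurableT_comp _ _ _ _ _ _ (fun x => x `^ 2)%E).
    exact: measurable_poweR.
  by apply: measurableT_comp => //; exact/measurable_EFinP.
have tri : (l2norm S P <= l2norm S (fun x => P x - s m x)%R + l2norm S (s m))%E.
  have minko := @minkowski_EFin _ _ _ S _ _ 2 mPs (msr _ (bs m)).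
  apply: le_trans (minko _); last by rewrite (ler_nat _ 1 2).
  rewrite /l2norm unlock; apply: gt0_ler_poweR.
  - by rewrite invr_ge0.
  - by rewrite in_itv /= integral_ge0 ?leey // => x _; exact: poweR_ge0.
  - by rewrite in_itv /= integral_ge0 ?leey // => x _; exact: poweR_ge0.
  apply: ge0_le_integral => //.
  - by move=> x _; exact: poweR_ge0.
  - exact: (mpow _ (mnormc _ mr mi)).
  - exact: (mpow _ (measurable_funD mPs (msr _ (bs m)))).
  - move=> x _ /=; rewrite lee_fin !powR_mulrn ?normr_ge0 //.
    rewrite lerXn2r ?nnegrE ?normr_ge0 // !ger0_norm ?addr_ge0 ?normc_ge0 //.
    by rewrite -[P x in leLHS](subrK (s m x)); exact: le_normcD.
move: tri Pm; rewrite (l2normE (bs m)) -(fineK Pfn) /=.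
move: (fine _) (L2 _) => p b; case: (l2norm S _) => [a| |] //=.
by rewrite -EFinD -EFinM lee_fin lte_fin lee_fin => ? ?; lra.
Qed.

End ComplexIntegral.

(** * Harmonic polynomials on the sphere *)

(** Suited to properties with a product rule, such as boundedness or a first-order expansion. *)
Lemma mpoly_ring_ind (K : comNzRingType) (m : nat) (P : mpoly m K -> Prop) :
  (forall c, P (mpolyC m c)) -> (forall i, P 'X_i) ->
  (forall p q, P p -> P q -> P (p + q)) ->
  (forall p q, P p -> P q -> P (p * q)) -> forall p, P p.
Proof.
move=> PC PX PD PM; elim/mpolyind => [|c mm p _ _ Pp]; first by rewrite -mpolyC0.
apply: (PD) => //; rewrite -mul_mpolyC; apply: (PM) => //; rewrite mpolyXE_id.
apply: (big_ind P) => [||i _]; [exact: (PC 1) | by move=> *; apply: (PM) |].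
elim: (mm i) => [|k IH]; first exact: (PC 1).
by rewrite exprS; apply: (PM).
Qed.

HB.lock Definition ev (R : realType) (n : nat) (p : mpoly n.+1 R[i])
    (x : sphere R n) : R[i] :=
  meval (map_mx (real_complex R) (spoint x) 0) p.

(** Points of the sphere are real, so conjugating the coefficients conjugates the values, and the
    integrand of an inner product of polynomials is again a polynomial. *)
HB.lock Definition conjmp (R : realType) (n : nat) (p : mpoly n.+1 R[i]) :
    mpoly n.+1 R[i] := map_mpoly conjc p.

Section PolynomialsOnSphere.
Context (R : realType) (n : nat).
Implicit Types (p q : mpoly n.+1 R[i]) (u v e : 'rV[R]_n.+1) (x : sphere R n).

Local Notation toC := (map_mx (real_complex R)).

Lemma evE p x : ev p x = meval (toC (spoint x) 0) p.
Proof. by rewrite ev.unlock. Qed.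

Lemma ev_XE i x : ev 'X_i x = (spoint x 0 i)%:C%C.
Proof. by rewrite !evE mevalXU mxE. Qed.

Lemma evD p q : ev (p + q) = (fun x => ev p x + ev q x).
Proof. by apply/funext => x; rewrite !evE mevalD. Qed.

Lemma evB p q : ev (p - q) = (fun x => ev p x - ev q x).
Proof. by apply/funext => x; rewrite !evE mevalB. Qed.

Lemma evM p q : ev (p * q) = (fun x => ev p x * ev q x).
Proof. by apply/funext => x; rewrite !evE mevalM. Qed.

Lemma evZ c p : ev (c *: p) = (fun x => c * ev p x).
Proof. by apply/funext => x; rewrite !evE mevalZ. Qed.

Lemma evC (c : R[i]) : ev (mpolyC n.+1 c) = (fun=> c).
Proof. by apply/funext => x; rewrite !evE mevalC. Qed.

Lemma ev0 : ev (0 : mpoly n.+1 R[i]) = (fun=> 0).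
Proof. by rewrite -mpolyC0 evC. Qed.

Lemma ev_sum (I : Type) (s : seq I) (P : pred I) (F : I -> mpoly n.+1 R[i]) :
  ev (\sum_(i <- s | P i) F i) = (fun x => \sum_(i <- s | P i) ev (F i) x).
Proof.
apply/funext => x; rewrite evE raddf_sum.
by apply: eq_bigr => i _; rewrite evE.
Qed.

Lemma sum_sqr_spoint x :
  \sum_i toC (spoint x) 0 i * toC (spoint x) 0 i = 1.
Proof.
rewrite -[RHS](rmorph1 (real_complex R)) -(spoint_dotp x) rmorph_sum.
by apply: eq_bigr => i _; rewrite !mxE -rmorphM.
Qed.

Lemma ev_sqnormpM p : ev (sqnormp _ _ * p) = ev p.
Proof.
by apply/funext => x; rewrite evM evE meval_sqnormp sum_sqr_spoint mul1r.
Qed.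

Lemma ev_linmp u x : ev (linmp (toC u)) x = (dotp u (spoint x))%:C%C.
Proof.
rewrite /linmp ev_sum rmorph_sum; apply: eq_bigr => i _.
by rewrite evZ ev_XE mxE -rmorphM.
Qed.

Lemma bm_ev p : bm (ev p).
Proof.
elim/mpoly_ring_ind: p => [c|i|p q bp bq|p q bp bq].
- by rewrite evC; exact: bm_cst.
- have -> : ev 'X_i = fun x => (spoint x 0 i)%:C%C.
    by apply/funext => x; rewrite ev_XE.
  split; last exact: bmr_cst.
  split; last by exists 1 => x; exact: spoint_coord_le1.
  by apply: continuous_measurable_sphere; exact: spoint_coord_continuous.
- by rewrite evD; exact: bmD.
- by rewrite evM; exact: bmM.
Qed.

Lemma conjmpE p : conjmp p = map_mpoly conjc p.
Proof. by rewrite conjmp.unlock. Qed.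

Lemma conjmpD p q : conjmp (p + q) = conjmp p + conjmp q.
Proof. by rewrite !conjmpE; exact: (rmorphD (map_mpoly conjc)). Qed.

Lemma conjmpM p q : conjmp (p * q) = conjmp p * conjmp q.
Proof. by rewrite !conjmpE; exact: (rmorphM (map_mpoly conjc)). Qed.

Lemma conjmp0 : conjmp (0 : mpoly n.+1 R[i]) = 0.
Proof. by rewrite conjmpE; exact: (rmorph0 (map_mpoly conjc)). Qed.

Lemma conjmp1 : conjmp (1 : mpoly n.+1 R[i]) = 1.
Proof. by rewrite conjmpE; exact: (rmorph1 (map_mpoly conjc)). Qed.

Lemma conjmpN p : conjmp (- p) = - conjmp p.
Proof. by rewrite !conjmpE; exact: (rmorphN (map_mpoly conjc)). Qed.

Lemma conjmpZ c p : conjmp (c *: p) = conjc c *: conjmp p.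
Proof. by rewrite !conjmpE; exact: map_mpolyZ. Qed.

Lemma conjmp_sum (I : Type) (s : seq I) (P : pred I) (F : I -> mpoly n.+1 R[i]) :
  conjmp (\sum_(i <- s | P i) F i) = \sum_(i <- s | P i) conjmp (F i).
Proof.
apply: (big_morph (@conjmp R n)); [exact: conjmpD|exact: conjmp0].
Qed.

Lemma mcoeff_conjmp mm p : mcoeff mm (conjmp p) = conjc (mcoeff mm p).
Proof. by rewrite conjmpE mcoeff_map_mpoly. Qed.

Lemma conjmpK : involutive (@conjmp R n).
Proof. by move=> p; apply/mpolyP => mm; rewrite !mcoeff_conjmp conjcK. Qed.

Lemma conjmp_mderiv i p : conjmp (mderiv i p) = mderiv i (conjmp p).
Proof.
apply/mpolyP => mm; rewrite mcoeff_conjmp !mcoeff_deriv mcoeff_conjmp.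
exact: (rmorphMn conjc).
Qed.

Lemma ev_conjmp p x : ev (conjmp p) x = conjc (ev p x).
Proof.
elim/mpoly_ring_ind: p => [c|i|p q bp bq|p q bp bq].
- by rewrite conjmpE map_mpolyC !evC.
- by rewrite conjmpE map_mpolyX ev_XE conjc_real.
- rewrite conjmpD (evD p) (evD (conjmp p)) bp bq.
  by case: (ev p x) (ev q x) => a b [c d]; congr Complex; rewrite opprD.
- rewrite conjmpM (evM p) (evM (conjmp p)) bp bq.
  by case: (ev p x) (ev q x) => a b [c d]; congr Complex; ring.
Qed.

Lemma dotpC u v : dotp u v = dotp v u.
Proof. by apply: eq_bigr => i _; rewrite mulrC. Qed.

Lemma dotpDl u v e : dotp (u + v) e = dotp u e + dotp v e.
Proof. by rewrite -big_split; apply: eq_bigr => i _; rewrite mxE mulrDl. Qed.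

Lemma dotpZl (a : R) u e : dotp (a *: u) e = a * dotp u e.
Proof. by rewrite /dotp mulr_sumr; apply: eq_bigr => i _; rewrite mxE mulrA. Qed.

Lemma dotpNl u e : dotp (- u) e = - dotp u e.
Proof. by rewrite /dotp -sumrN; apply: eq_bigr => i _; rewrite mxE mulNr. Qed.

Lemma dotpE u v : u *m v^T = (dotp u v)%:M.
Proof.
apply/matrixP => i j; rewrite !ord1 !mxE eqxx mulr1n.
by apply: eq_bigr => k _; rewrite mxE.
Qed.

Section Givens.
Context (u v : 'rV[R]_n.+1) (uu : dotp u u = 1) (vv : dotp v v = 1)
  (uv : dotp u v = 0).

(** Rotation in the plane of [u] and [v], by the angle with sine [s] and nonnegative cosine. It
    fixes every vector orthogonal to both. *)
Definition givens (s : R) : 'M[R]_n.+1 :=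
  1%:M + (Num.sqrt (1 - s ^+ 2) - 1) *: (u^T *m u + v^T *m v)
  + s *: (u^T *m v - v^T *m u).

Lemma mulmx_givens (s : R) (x : 'rV[R]_n.+1) :
  x *m givens s = x + (Num.sqrt (1 - s ^+ 2) - 1) *: (dotp x u *: u + dotp x v *: v)
    + s *: (dotp x u *: v - dotp x v *: u).
Proof.
rewrite /givens !mulmxDr mulmx1 -!scalemxAr mulmxDr mulmxBr !mulmxA !dotpE.
by rewrite !mul_scalar_mx.
Qed.

Lemma givens_orthogonal s : 0 <= s <= 1 -> givens s *m (givens s)^T = 1%:M.
Proof.
move=> /andP[s0 s1].
have s2 : 0 <= 1 - s ^+ 2 by rewrite subr_ge0 expr_le1.
have -> : (givens s)^T = givens (- s).
  apply/matrixP => i j; rewrite !mxE !big_ord1 !mxE sqrrN eq_sym.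
  by ring.
apply/row_matrixP => i; rewrite row_mul !rowE mulmx1.
set x := delta_mx 0 i; rewrite !mulmx_givens sqrrN.
rewrite !(dotpDl, dotpZl, dotpNl) uu vv uv (dotpC v u) uv.
move: (sqr_sqrtr s2); set c := Num.sqrt _ => c2.
apply/rowP => j; rewrite !mxE.
move: (dotp x u) (dotp x v) => a b.
have c2s2 : c ^+ 2 + s ^+ 2 - 1 = 0 by rewrite c2; ring.
(* The composite differs from the identity only in the plane of [u] and [v], by the factor c^2 + s^2
   - 1. *)
transitivity (x 0 j + (c ^+ 2 + s ^+ 2 - 1) * (a * u 0 j + b * v 0 j)).
  by rewrite /x !mxE; ring.
by rewrite c2s2 mul0r addr0 /x mxE.
Qed.

Lemma dotp_givens s (x e : 'rV[R]_n.+1) :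
  dotp u e = 0 -> dotp v e = 0 -> dotp e (x *m givens s) = dotp e x.
Proof.
move=> ue ve; rewrite dotpC mulmx_givens !(dotpDl, dotpZl, dotpNl) ue ve.
by rewrite !mulr0 oppr0 !addr0 !mulr0 !addr0 dotpC.
Qed.

End Givens.
End PolynomialsOnSphere.

(** * Integrals of infinitesimal rotations vanish *)

Section InfinitesimalRotation.
Context (R : realType) (n : nat) (S : probability (sphere R n) R)
  (S_uniform : uniform_sphere S).
Implicit Types (p q : mpoly n.+1 R[i]) (u v e : 'rV[R]_n.+1) (x : sphere R n).

Local Notation toC := (map_mx (real_complex R)).

(** Cauchy-Schwarz against the constant 1. *)
Lemma cint_bound (f : sphere R n -> R[i]) C : bm f -> 0 <= C ->
  (forall x, normc (f x) <= C) -> normc (cint S f) <= C.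
Proof.
move=> bf C0 fC; have b1 := bm_cst n (1 : R[i]).
have -> : cint S f = l2inner S f (fun=> 1).
  by rewrite l2innerE; congr cint; apply/funext => x; rewrite conjc1 mulr1.
have f_le := L2_le_bound S bf C0 fC.
have one_le : L2 S (fun=> 1) <= 1.
  by apply: L2_le_bound => // x; rewrite ComplexField.Normc.normc1.
apply: (le_trans (l2inner_cauchy S bf b1)); rewrite -[leRHS]mulr1.
by apply: ler_pM => //; exact: L2_ge0.
Qed.

Lemma normcM (x y : R[i]) : normc (x * y) = normc x * normc y.
Proof. exact: ComplexField.Normc.normcM. Qed.

Lemma normc_real (a : R) : normc a%:C%C = `|a|.
Proof. by rewrite normcE2 /= expr0n addr0 sqrtr_sqr. Qed.

(** First-order expansion along a rotation, with remainder uniform in [x]. On a variable the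
    remainder comes from 1 - c <= s^2, where c is the cosine; the Leibniz rule for [rotd] propagates
    the bound to products. *)
Lemma givens_taylor u v (uu : dotp u u = 1) (vv : dotp v v = 1)
    (uv : dotp u v = 0) p :
  exists2 C : R, 0 <= C & forall s (s01 : 0 <= s <= 1) x,
    normc (ev p (rotate (givens_orthogonal uu vv uv s01) x) - ev p x
           - s%:C%C * ev (rotd (toC u) (toC v) p) x) <= C * s ^+ 2.
Proof.
elim/mpoly_ring_ind: p => [c|i|p q [C C0 pC] [D D0 qD]|p q [C C0 pC] [D D0 qD]].
- exists 0 => // s s01 x.
  have -> : rotd (toC u) (toC v) (mpolyC _ c) = 0.
    by rewrite rotdE /dirderiv !big1 ?mulr0 ?subrr // => j _; rewrite mderivC scaler0.
  by rewrite ev0 !evC mulr0 subr0 subrr ComplexField.Normc.normc0 mul0r.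
- have dX w : dirderiv (toC w) ('X_i : mpoly n.+1 R[i]) = mpolyC _ (w 0 i)%:C%C.
    rewrite /dirderiv (bigD1 i) //= big1 => [|j ji].
      by rewrite mxE mderivXE eqxx addr0 -mul_mpolyC mulr1.
    by rewrite mderivXE (negPf ji) scaler0.
  have bw w : exists2 W : R, 0 <= W & forall x, `|dotp (spoint x) w| <= W.
    exists (\sum_j `|w 0 j|) => [|x]; first exact: sumr_ge0.
    rewrite (le_trans (ler_norm_sum _ _ _)) // ler_sum // => j _.
    by rewrite normrM ler_piMl // spoint_coord_le1.
  have [U U0 uU] := bw u; have [V V0 vV] := bw v.
  exists (U * `|u 0 i| + V * `|v 0 i|) => [|s s01 x].
    by rewrite addr_ge0 // mulr_ge0.
  have s2 : 0 <= 1 - s ^+ 2.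
    by case/andP: s01 => s0 s1; rewrite subr_ge0 expr_le1.
  rewrite !ev_XE rotdE !dX evB !evM !evC !ev_linmp spoint_rotate mulmx_givens !mxE.
  rewrite (dotpC u) (dotpC v); move: (uU x) (vV x).
  move: (dotp _ u) (dotp _ v) => a b aU bV.
  set c := Num.sqrt _.
  rewrite (_ : _ - _ - _ = ((c - 1) * (a * u 0 i + b * v 0 i))%:C%C); last by ring.
  rewrite normc_real normrM mulrC ler_pM //.
    by rewrite (le_trans (ler_normD _ _)) // !normrM lerD // ler_wpM2r.
  have c1 : c <= 1 by rewrite -sqrtr1 ler_wsqrtr // lerBlDr lerDl sqr_ge0.
  rewrite distrC ger0_norm ?subr_ge0 // lerBlDr -lerBlDl.
  have c2 := sqr_sqrtr s2; rewrite -/c in c2; rewrite -c2 expr2.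
  by rewrite ler_piMr // sqrtr_ge0.
- exists (C + D) => [|s s01 x]; first exact: addr_ge0.
  rewrite rotdD (evD p q) (evD (rotd _ _ p)) mulrDl.
  move: (pC s s01 x) (qD s s01 x).
  move: (ev p (rotate _ x)) (ev q (rotate _ x)) (ev (rotd _ _ p) x).
  move: (ev (rotd _ _ q) x) (ev p x) (ev q x).
  move=> dq px qx py qy dp hp hq.
  have -> : py + qy - (px + qx) - s%:C%C * (dp + dq) =
      (py - px - s%:C%C * dp) + (qy - qx - s%:C%C * dq) by ring.
  by rewrite (le_trans (le_normcD _ _)) // lerD.
have [P P0 pP] := bm_bounded (bm_ev p).
have [Q Q0 qQ] := bm_bounded (bm_ev q).
have [P' P'0 pP'] := bm_bounded (bm_ev (rotd (toC u) (toC v) p)).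
have [Q' Q'0 qQ'] := bm_bounded (bm_ev (rotd (toC u) (toC v) q)).
exists (C * Q + P * D + P' * Q' + P' * D) => [|s s01 x].
  by rewrite !addr_ge0 // mulr_ge0 // ltW.
rewrite rotdM evD (evM p q) (evM _ q) (evM p); move: (pC s s01 x) (qD s s01 x).
move: (pP x) (pP' x) (qQ' x) (qQ (rotate (givens_orthogonal uu vv uv s01) x)).
move: (ev p (rotate _ x)) (ev q (rotate _ x)) (ev (rotd _ _ p) x).
move: (ev (rotd _ _ q) x) (ev p x) (ev q x).
move=> dq px qx py qy dp hp hp' hq' hq.
set E := (_ - _ - _); set F := (_ - _ - _) => hE hF.
(* [E] and [F] are the remainders of the two factors. The four terms match the four summands of the
   constant, the last one through s <= 1. *)
rewrite (_ : _ - _ - _ = E * qy + px * F + (s ^+ 2)%:C%C * (dp * dq)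
   + s%:C%C * (dp * F)); last by rewrite /E /F; ring.
case/andP: s01 => s0 s1.
have nD (a b c d : R[i]) : normc (a + b + c + d) <=
    normc a + normc b + normc c + normc d.
  by do 3 (rewrite (le_trans (le_normcD _ _)) ?lerD2r //).
rewrite (le_trans (nD _ _ _ _)) // !normcM !normc_real !mulrDl.
have s2 : 0 <= s ^+ 2 by exact: sqr_ge0.
rewrite (ger0_norm s0) (ger0_norm s2).
have n0 := @normc_ge0 R.
apply: lerD; [apply: lerD; [apply: lerD|]|].
- by rewrite mulrAC; apply: ler_pM.
- by rewrite -mulrA; apply: ler_pM.
- by rewrite mulrC; apply: ler_pM => //; [exact: mulr_ge0|apply: ler_pM].
- rewrite -mulrA -[leRHS]mul1r; apply: ler_pM => //; first by rewrite !mulr_ge0.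
  by apply: ler_pM.
Qed.

Lemma row_normalize (v : 'rV[R]_n.+1) : v != 0 ->
  exists a w, [/\ v = a *: w, dotp w w = 1 & forall z, dotp v z = 0 -> dotp w z = 0].
Proof.
move=> v0; pose a := Num.sqrt (dotp v v).
have vv0 : 0 < dotp v v.
  have [j vj] : exists j, v 0 j != 0.
    apply/existsP; apply: contraNT v0 => /existsPn v0; apply/eqP/rowP => j.
    by rewrite mxE; apply/eqP; rewrite -[_ == _]negbK; exact: v0.
  rewrite /dotp (bigD1 j) //= ltr_pwDl // -?expr2 ?exprn_even_gt0 //.
  by apply: sumr_ge0 => k _; rewrite -expr2 sqr_ge0.
have a0 : a != 0 by rewrite gt_eqF // sqrtr_gt0.
exists a, (a^-1 *: v); split.
- by rewrite scalerA divff // scale1r.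
- rewrite dotpZl dotpC dotpZl -[dotp v v]sqr_sqrtr ?ltW // -/a.
  by field.
- by move=> z vz; rewrite dotpZl vz mulr0.
Qed.

(** A rotation in the plane of [u] and [v] preserves the measure and the weight [phi], whose pole is
    orthogonal to that plane. Integrating the expansion of [p] leaves s |D| <= C W s^2 for all small
    s, hence D = 0. No regularity of [phi] enters, as only [p] is differentiated. *)
Lemma cint_rotd_unit e (phi : R -> R[i]) p u v :
  bm (fun x => phi (dotp e (spoint x))) ->
  dotp u u = 1 -> dotp v v = 1 -> dotp u v = 0 -> dotp u e = 0 -> dotp v e = 0 ->
  cint S (fun x => ev (rotd (toC u) (toC v) p) x * phi (dotp e (spoint x))) = 0.
Proof.
set w := (fun x => _) => bw uu vv uv ue ve.
have bd := bm_ev (rotd (toC u) (toC v) p).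
set D := cint S _; have [W W0 wW] := bm_bounded bw.
have [C C0 pC] := givens_taylor uu vv uv p.
have key s (s01 : 0 <= s <= 1) : s * normc D <= C * W * s ^+ 2.
  pose rs := rotate (givens_orthogonal uu vv uv s01).
  have brs f : bm f -> bm (fun x => f (rs x)).
    move=> [[fr [Mr fMr]] [fi [Mi fMi]]].
    have mrs : measurable_fun setT rs by exact: rotate_measurable.
    split; split; [|by exists Mr => x; exact: fMr| |by exists Mi => x; exact: fMi].
      exact: (measurableT_comp fr mrs).
    exact: (measurableT_comp fi mrs).
  have bp := bm_ev p.
  have bdiff := bmB (bmB (brs _ bp) bp) (bmZ s%:C%C bd).
  have E : cint S (fun x => (ev p (rs x) - ev p x
      - s%:C%C * ev (rotd (toC u) (toC v) p) x) * w x) = - (s%:C%C * D).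
    have wrs x : w (rs x) = w x by rewrite /w spoint_rotate dotp_givens.
    have bpw := bmM bp bw; have bdw := bmM bd bw.
    rewrite (_ : (fun x => _) = fun x =>
        ev p (rs x) * w (rs x) + (-1) * (ev p x * w x)
        + (- s%:C%C) * (ev (rotd (toC u) (toC v) p) x * w x)); last first.
      by apply/funext => x; rewrite wrs; ring.
    have brpw : bm (fun x => ev p (rs x) * w (rs x)) := brs _ bpw.
    have b1 := bmZ (-1) bpw; have b2 := bmZ (- s%:C%C) bdw.
    rewrite (cintD S (bmD brpw b1) b2) (cintD S brpw b1) (cintZ S _ bpw) (cintZ S _ bdw).
    by rewrite (cint_rotate S_uniform _ bpw) mulN1r subrr add0r mulNr.
  case/andP: (s01) => s0 s1.
  have -> : s * normc D = normc (- (s%:C%C * D)).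
    by rewrite normcN normcM normc_real ger0_norm.
  rewrite -E mulrAC; apply: cint_bound.
  - exact: bmM.
  - by rewrite !mulr_ge0 ?sqr_ge0 // ltW.
  - by move=> x; rewrite normcM; apply: ler_pM; rewrite ?normc_ge0 ?pC.
apply: ComplexField.Normc.eq0_normc; apply/eqP.
rewrite eq_le normc_ge0 andbT leNgt; apply/negP => D0.
(* Small enough that C W s <= |D| / 2, against [key]. *)
pose s := Num.min 1 (normc D / (2 * (C * W + 1))).
have CW : 0 <= C * W by rewrite mulr_ge0 // ltW.
have s0 : 0 < s by rewrite lt_min ltr01 divr_gt0 // mulr_gt0 // ltr_wpDl.
have s1 : s <= 1 by rewrite ge_min lexx.
have := key s; rewrite (ltW s0) s1 => /(_ isT).
rewrite expr2 mulrCA ler_pM2l // => Ds.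
have : s <= normc D / (2 * (C * W + 1)) by rewrite ge_min lexx orbT.
rewrite ler_pdivlMr; last by rewrite mulr_gt0 // ltr_wpDl.
by move: Ds D0 s0 CW; move: (normc D) (C * W) s {s1} => d a s; nra.
Qed.

(** The integral is bilinear and alternating in [u] and [v], so Gram-Schmidt reduces it to an
    orthonormal pair, still orthogonal to [e]. *)
Lemma cint_rotd e (phi : R -> R[i]) p u v :
  bm (fun x => phi (dotp e (spoint x))) -> dotp u e = 0 -> dotp v e = 0 ->
  cint S (fun x => ev (rotd (toC u) (toC v) p) x * phi (dotp e (spoint x))) = 0.
Proof.
set w := (fun x => _) => bw ue ve.
pose J u v := cint S (fun x => ev (rotd (toC u) (toC v) p) x * w x).
have JPr (a : R) u1 v1 v2 : J u1 (a *: v1 + v2) = a%:C%C * J u1 v1 + J u1 v2.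
  rewrite /J -cintZ; last by apply: bmM => //; exact: bm_ev.
  rewrite -cintD; [|by apply: bmZ; apply: bmM => //; exact: bm_ev
                   |by apply: bmM => //; exact: bm_ev].
  congr cint; apply/funext => x.
  by rewrite map_mxD map_mxZ rotdPr evD evZ mulrDl mulrA.
have JN u1 v1 : J v1 u1 = - J u1 v1.
  rewrite /J -mulN1r -cintZ; last by apply: bmM => //; exact: bm_ev.
  congr cint; apply/funext => x.
  by rewrite rotdC -scaleN1r evZ mulrA.
have Jid u1 : J u1 u1 = 0.
  rewrite /J -[RHS](cint_cst S 0); congr cint; apply/funext => x.
  by rewrite rotd_id ev0 mul0r.
have J0 u1 : J u1 0 = 0.
  have := JPr 1 u1 0 0; rewrite scaler0 addr0 mul1r => /eqP.
  by rewrite -subr_eq subrr eq_sym => /eqP.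
have JZr (a : R) u1 v1 : J u1 (a *: v1) = a%:C%C * J u1 v1.
  by rewrite -[a *: v1]addr0 JPr J0 addr0.
have Jort u1 v1 : dotp u1 u1 = 1 -> dotp u1 e = 0 -> dotp v1 e = 0 -> J u1 v1 = 0.
  move=> uu ue1 ve1; pose v2 := v1 - dotp v1 u1 *: u1.
  have -> : v1 = dotp v1 u1 *: u1 + v2 by rewrite /v2 addrC subrK.
  rewrite JPr Jid mulr0 add0r; have [->//|] := eqVneq v2 0.
  move=> /row_normalize[a [v3 [v2E vv3 v3o]]]; rewrite v2E JZr.
  rewrite [J _ _]cint_rotd_unit ?mulr0 //.
    rewrite dotpC; apply: v3o.
    by rewrite /v2 dotpDl dotpNl dotpZl uu mulr1 subrr.
  by apply: v3o; rewrite /v2 dotpDl dotpNl dotpZl ue1 ve1 mulr0 subrr.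
rewrite -[LHS]/(J u v); have [->|] := eqVneq u 0; first by rewrite JN J0 oppr0.
move=> /row_normalize[a [u1 [uE uu1 u1o]]].
by rewrite uE JN JZr JN Jort ?oppr0 ?mulr0 ?oppr0 //; exact: u1o.
Qed.

End InfinitesimalRotation.

(** * Orthogonality of harmonic polynomials *)

Section HarmonicInnerProduct.
Context (R : realType) (n : nat) (S : probability (sphere R n) R)
  (S_uniform : uniform_sphere S).
Implicit Types (p q h : mpoly n.+1 R[i]) (u v e : 'rV[R]_n.+1) (x : sphere R n).

Local Notation toC := (map_mx (real_complex R)).

Definition ip p q : R[i] := l2inner S (ev p) (ev q).

Lemma ipE p q : ip p q = cint S (ev (p * conjmp q)).
Proof.
rewrite /ip l2innerE; congr cint; apply/funext => x.
by rewrite evM ev_conjmp.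
Qed.

Lemma ip1r p : ip p 1 = cint S (ev p).
Proof.
by rewrite ipE conjmp1 mulr1.
Qed.

Lemma ipC p q : ip q p = conjc (ip p q).
Proof. exact: l2innerC (bm_ev p) (bm_ev q). Qed.

Lemma ipDl p q h : ip (p + q) h = ip p h + ip q h.
Proof. by rewrite /ip evD l2innerDl //; exact: bm_ev. Qed.

Lemma ipZl c p h : ip (c *: p) h = c * ip p h.
Proof. by rewrite /ip evZ l2innerZl //; exact: bm_ev. Qed.

Lemma ipZr c p h : ip h (c *: p) = conjc c * ip h p.
Proof. by rewrite /ip evZ l2innerZr //; exact: bm_ev. Qed.

Lemma ipBl p q h : ip (p - q) h = ip p h - ip q h.
Proof. by rewrite /ip evB l2innerBl //; exact: bm_ev. Qed.

Lemma ipBr p q h : ip h (p - q) = ip h p - ip h q.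
Proof. by rewrite /ip evB l2innerBr //; exact: bm_ev. Qed.

Lemma ip0l h : ip 0 h = 0.
Proof. by rewrite -(scale0r 0) ipZl mul0r. Qed.

Lemma ip_suml (I : Type) (s : seq I) (P : pred I) (F : I -> mpoly n.+1 R[i]) h :
  ip (\sum_(i <- s | P i) F i) h = \sum_(i <- s | P i) ip (F i) h.
Proof. by rewrite /ip ev_sum l2inner_suml // => *; exact: bm_ev. Qed.

Lemma ip_sumr (I : Type) (s : seq I) (P : pred I) (F : I -> mpoly n.+1 R[i]) h :
  ip h (\sum_(i <- s | P i) F i) = \sum_(i <- s | P i) ip h (F i).
Proof. by rewrite /ip ev_sum l2inner_sumr // => *; exact: bm_ev. Qed.

Lemma ipMl p q h : ip (p * q) h = ip q (conjmp p * h).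
Proof.
rewrite /ip !l2innerE; congr cint; apply/funext => x.
by rewrite !evM ev_conjmp rmorphM /= conjcK mulrAC mulrA (mulrC (ev q x)) mulrAC.
Qed.

Lemma ip_eq0 p q : ip p p = 0 -> ip p q = 0.
Proof.
rewrite {1}/ip (l2inner_self S (bm_ev p)) => /complexI/eqP.
rewrite expf_eq0 /= => /eqP p0.
have := l2inner_cauchy S (bm_ev p) (bm_ev q); rewrite p0 mul0r => pq0.
apply: ComplexField.Normc.eq0_normc; apply/eqP.
by rewrite eq_le pq0 normc_ge0.
Qed.

Lemma conjmp_rotd u v p :
  conjmp (rotd (toC u) (toC v) p) = rotd (toC u) (toC v) (conjmp p).
Proof.
have cl (w : 'rV[R]_n.+1) : conjmp (linmp (toC w)) = linmp (toC w).
  rewrite conjmp_sum; apply: eq_bigr => i _.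
  by rewrite conjmpZ mxE conjc_real; congr (_ *: _); rewrite conjmpE; exact: map_mpolyX.
have cd (w : 'rV[R]_n.+1) : conjmp (dirderiv (toC w) p) = dirderiv (toC w) (conjmp p).
  rewrite conjmp_sum; apply: eq_bigr => i _.
  by rewrite conjmpZ mxE conjc_real conjmp_mderiv.
rewrite !rotdE conjmpD conjmpN (conjmpM (linmp (toC u))) (conjmpM (linmp (toC v))).
by rewrite !cl !cd.
Qed.

Lemma conjmp_laplacian p : conjmp (laplacian p) = laplacian (conjmp p).
Proof.
rewrite conjmp_sum; apply: eq_bigr => i _.
by rewrite !conjmp_mderiv.
Qed.

Lemma homog_conjmp k p : p \is homog k -> conjmp p \is homog k.
Proof.
move=> /dhomogP pk; apply/dhomogP => mm; rewrite mcoeff_msupp mcoeff_conjmp.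
by rewrite conjc_eq0 -mcoeff_msupp; exact: pk.
Qed.

(** With the pole 0 and weight 1, the orthogonality conditions of [cint_rotd] become trivial. *)
Lemma cint_ev_rotd u v p : cint S (ev (rotd (toC u) (toC v) p)) = 0.
Proof.
have d0 w : dotp w (0 : 'rV[R]_n.+1) = 0.
  by rewrite /dotp big1 // => i _; rewrite mxE mulr0.
have b1 : bm (fun x : sphere R n => (fun=> 1 : R[i]) (dotp 0 (spoint x))).
  exact: bm_cst.
have := @cint_rotd R n S S_uniform 0 (fun=> 1) p u v b1 (d0 u) (d0 v).
move=> <-.
by congr cint; apply/funext => x; rewrite mulr1.
Qed.

(** Integration by parts: a rotation is a derivation, commutes with [conjmp] because [u] and [v] are
    real, and integrates to zero. *)
Lemma ip_rotd u v p q :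
  ip (rotd (toC u) (toC v) p) q = - ip p (rotd (toC u) (toC v) q).
Proof.
apply/eqP; rewrite -addr_eq0 !ipE conjmp_rotd -cintD; try exact: bm_ev.
have := cint_ev_rotd u v (p * conjmp q).
by rewrite rotdM evD => ->.
Qed.

Lemma map_delta (i : 'I_n.+1) : toC (delta_mx 0 i : 'rV[R]_n.+1) = delta_mx 0 i.
Proof. by apply/rowP => j; rewrite !mxE rmorph_nat. Qed.

(** Restriction to the sphere is injective on homogeneous polynomials. A [p] of norm 0 is orthogonal
    to everything, and so are its rotations by skew-adjointness; [sqnormp_mderiv] then gives norm 0
    to each partial derivative, which has smaller degree. *)
Lemma homog_ip_eq0 k p : p \is homog k -> ip p p = 0 -> p = 0.
Proof.
elim: k p => [|k IH] p pk pp.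
  have := ip_eq0 1 pp; rewrite ip1r (homog0P pk) evC cint_cst => ->.
  by rewrite mpolyC0.
apply: (homog_mderiv_eq0 pk) => i; apply: IH; first exact: homog_mderiv.
have null q : ip p q = 0 by exact: ip_eq0.
have rnull u v q : ip (rotd (toC u) (toC v) p) q = 0 by rewrite ip_rotd null oppr0.
rewrite /ip -ev_sqnormpM -/(ip _ _).
rewrite (sqnormp_mderiv i pk).
rewrite ipDl ip_suml big1 ?add0r => [|j _]; last first.
  by rewrite ipMl -!map_delta rnull.
by rewrite mulrnAr -scaler_nat ipZl ipMl null mulr0.
Qed.

Lemma cint_ev_mulrn p (j : nat) :
  cint S (ev (p *+ j)) = cint S (ev p) * j%:R.
Proof.
by rewrite -scaler_nat evZ cintZ; [rewrite mulrC|exact: bm_ev].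
Qed.

(** The integral of [homogM_rotd]: k (n - 1 + k + l) times the integral of p q equals that of the
    product of gradients. *)
Lemma cint_ev_grad k l p q : solidharm k p -> q \is homog l ->
  cint S (ev (p * q)) * (k * (n.+1 + k + l))%:R =
  cint S (ev (p * q)) * (k.*2)%:R
    + cint S (ev (\sum_j (mderiv j p * mderiv j q))).
Proof.
move=> [pk Lp] ql; have := congr1 (fun F => cint S (ev F)) (homogM_rotd pk Lp ql).
rewrite (evD (\sum_i _)) (evD (p * q *+ _)) !cintD; try exact: bm_ev.
rewrite !cint_ev_mulrn ev_sqnormpM -[X in X + _](ip1r (\sum_i _)) ip_suml.
rewrite big1 ?add0r // => i _; rewrite ip_suml big1 // => j _.
by rewrite ip1r -!map_delta cint_ev_rotd.
Qed.

(** The gradient term of [cint_ev_grad] is symmetric in the two factors, so exchanging them gives (k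
    - l)(n - 1 + k + l) <p, q> = 0; the second factor is nonzero since k and l are not both 0. *)
Lemma ip_orthogonal k l p q : (0 < n)%N -> k != l ->
  solidharm k p -> solidharm l q -> ip p q = 0.
Proof.
move=> n0 kl Vp [ql Lq]; rewrite ipE.
have Vq : solidharm l (conjmp q).
  by split; [exact: homog_conjmp|rewrite -conjmp_laplacian Lq; exact: conjmp0].
have := cint_ev_grad Vp (proj1 Vq); have := cint_ev_grad Vq (proj1 Vp).
have -> : cint S (ev (conjmp q * p)) = cint S (ev (p * conjmp q)).
  by congr (cint S (ev _)); exact: mulrC.
have -> : cint S (ev (\sum_j mderiv j (conjmp q) * mderiv j p)) =
    cint S (ev (\sum_j mderiv j p * mderiv j (conjmp q))).
  by congr (cint S (ev _)); apply: eq_bigr => j _; exact: mulrC.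
move: (cint S (ev (p * _))) (cint S (ev (\sum_j _))) => a b I2 I1.
have : a * ((k%:R - l%:R) * (n.-1 + k + l)%:R) = 0.
  have -> : a * ((k%:R - l%:R) * (n.-1 + k + l)%:R) =
     (a * (k * (n.+1 + k + l))%:R - (a * (k.*2)%:R + b)) -
     (a * (l * (n.+1 + l + k))%:R - (a * (l.*2)%:R + b)).
    have nE : n.+1%:R = n.-1%:R + 2 :> R[i] by rewrite -natrD addn2 prednK.
    by rewrite -!addnn !natrM !natrD nE; ring.
  by rewrite I1 I2 !subrr.
move/eqP; rewrite mulf_eq0 => /orP[/eqP//|].
rewrite mulf_eq0 subr_eq0 eqr_nat (negPf kl) /= pnatr_eq0 !addn_eq0.
case/andP=> /andP[_ /eqP k0] /eqP l0.
by move: kl; rewrite k0 l0.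
Qed.

End HarmonicInnerProduct.

(** * Zonal harmonics and ridge functions *)

Section ReproducingKernel.
Context (R : realType) (n : nat) (S : probability (sphere R n) R)
  (S_uniform : uniform_sphere S) (n_gt1 : (1 < n)%N) (k m : nat)
  (b : 'I_m -> mpoly n.+1 R[i]) (bV : forall i, solidharm k (b i))
  (b_span : forall h, solidharm k h -> exists c : 'rV[R[i]]_m,
     h = \sum_i c 0 i *: b i)
  (b_free : forall c : 'rV[R[i]]_m, \sum_i c 0 i *: b i = 0 -> c = 0).
Implicit Types (p q h : mpoly n.+1 R[i]) (u v e : 'rV[R]_n.+1) (x : sphere R n).

Local Notation toC := (map_mx (real_complex R)).
Local Notation V := (@solidharm R[i] n.+1 k).

(** The Gram matrix is invertible: a vector in its left kernel yields a combination orthogonal to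
    every [b j], hence to itself. Its inverse is conjugated because [ip] is conjugate-linear on the
    right. *)
Lemma dual_basis : exists q : 'I_m -> mpoly n.+1 R[i],
  (forall i, V (q i)) /\ (forall i j, ip S (b i) (q j) = (i == j)%:R).
Proof.
pose G := \matrix_(i, j) ip S (b i) (b j).
have Gu : G \in unitmx.
  rewrite -row_free_unit -kermx_eq0; apply/eqP/row_matrixP => i.
  rewrite row0; apply: b_free; set c := row i _.
  have cG : c *m G = 0 by apply/sub_kermxP; exact: row_sub.
  have Vc : V (\sum_j c 0 j *: b j).
    by apply: solidharm_sum => j; exact: solidharmZ.
  apply: (homog_ip_eq0 S_uniform (proj1 Vc)); rewrite ip_sumr big1 // => j _.
  have E : \sum_l ip S (c 0 l *: b l) (b j) = (c *m G) 0 j.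
    by rewrite mxE; apply: eq_bigr => l _; rewrite ipZl [G _ _]mxE.
  by rewrite ipZr ip_suml E cG [X in _ * X]mxE mulr0.
exists (fun j => \sum_l conjc (invmx G l j) *: b l); split.
  by move=> i; apply: solidharm_sum => j; exact: solidharmZ.
move=> i j; rewrite ip_sumr; under eq_bigr do rewrite ipZr conjcK.
have /matrixP/(_ i j) := mulmxV Gu; rewrite !mxE => <-.
by apply: eq_bigr => l _; rewrite mxE mulrC.
Qed.

(** [Z] is the reproducing kernel at [x0]. Its diagonal is, up to conjugation, the
    rotation-invariant polynomial [K], hence constant on the sphere. *)
Lemma zonal_kernel x0 : exists2 Z, V Z &
  (forall h, V h -> ip S h Z = ev h x0) /\ ev Z x0 = m%:R.
Proof.
have [q [qV bq]] := dual_basis.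
have b_exp h : V h -> h = \sum_i ip S h (q i) *: b i.
  move=> /b_span[c ->]; apply: eq_bigr => i _; congr (_ *: _).
  rewrite ip_suml (bigD1 i) //= ipZl bq eqxx mulr1 big1 ?addr0 // => j ji.
  by rewrite ipZl bq (negPf ji) mulr0.
have q_exp h : V h -> h = \sum_i ip S h (b i) *: q i.
  move=> Vh; apply/eqP; rewrite -subr_eq0; apply/eqP.
  set d := _ - _; have Vd : V d.
    apply: (solidharmB Vh).
    by apply: solidharm_sum => i; exact: (solidharmZ _ (qV i)).
  apply: (homog_ip_eq0 S_uniform (proj1 Vd)).
  rewrite {2}(b_exp _ Vd) ip_sumr big1 // => i _; rewrite ipZr.
  suff -> : ip S d (b i) = 0 by rewrite mulr0.
  rewrite /d ipBl ip_suml (bigD1 i) //= ipZl big1 => [|j ji].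
    by rewrite (ipC S (b i) (q i)) bq eqxx conjc1 mulr1 addr0 subrr.
  by rewrite ipZl (ipC S (b i) (q j)) bq eq_sym (negPf ji) conjc0 mulr0.
pose K := \sum_i b i * conjmp (q i).
pose Z (y : sphere R n) := \sum_i conjc (ev (b i) y) *: q i.
have VZ y : V (Z y) by apply: solidharm_sum => i; exact: solidharmZ.
have repr y h : V h -> ip S h (Z y) = ev h y.
  move=> Vh; rewrite [in RHS](b_exp _ Vh) ev_sum ip_sumr.
  by apply: eq_bigr => i _; rewrite ipZr conjcK evZ mulrC.
have KZ y : ev (Z y) y = conjc (ev K y).
  rewrite /Z /K !ev_sum rmorph_sum; apply: eq_bigr => i _.
  by rewrite evZ evM ev_conjmp rmorphM /= conjcK.
(* By skew-adjointness, the matrices of a rotation in [b] and in the dual basis [q] are negative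
   conjugate transposes of each other. *)
have rotK u v : rotd (toC u) (toC v) K = 0.
  pose D p := rotd (toC u) (toC v) p.
  apply: (@rotd_pairing_eq0 _ _ _ _ _ (fun s t => ip S (D (b s)) (q t))
    (fun s t => conjc (ip S (D (q s)) (b t)))) => [s|s|s t].
  - exact: b_exp (solidharm_rotd _ _ (bV s)).
  - rewrite -conjmp_rotd {1}(q_exp _ (solidharm_rotd (toC u) (toC v) (qV s))).
    by rewrite conjmp_sum; apply: eq_bigr => t _; rewrite conjmpZ.
  - by rewrite -ipC /D ip_rotd.
have [c Kc] : exists c, forall y : sphere R n, ev K y = c.
  have Kk : K \is homog (k + k).
    apply: rpred_sum => i _; apply: dhomogM; first exact: (proj1 (bV i)).
    exact: homog_conjmp (proj1 (qV i)).
  have [|i j|c Kc] := rotation_invariant_const _ Kk.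
  - exact: ltnW.
  - by apply/eqP; rewrite -subr_eq0 -rotd_delta -!map_delta rotK.
  - by exists c => y; rewrite evE; apply: Kc; exact: sum_sqr_spoint.
(* The constant is the integral of [K], the sum of the m pairings <b_i, q_i> = 1. *)
have cm : c = m%:R.
  rewrite -(cint_cst S c) (_ : (fun=> c) = ev K); last first.
    by apply/funext => y; rewrite Kc.
  rewrite -ip1r ip_suml -[in RHS](card_ord m) -sum1_card natr_sum.
  apply: eq_bigr => i _; rewrite mulrC ipMl conjmpK mulr1.
  by rewrite bq eqxx.
exists (Z x0) => //; split; first by move=> h; exact: repr.
by rewrite KZ Kc cm; exact: conjc_nat.
Qed.

(* The Funk-Hecke phenomenon: a ridge function in direction [x0] pairs with
   harmonics of degree [k] through evaluation at [x0] only. *)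
Lemma l2inner_ridge_eq0 x0 (phi : R -> R[i]) h :
  bm (fun x => phi (dotp (spoint x0) (spoint x))) -> V h -> ev h x0 = 0 ->
  l2inner S (ev h) (fun x => phi (dotp (spoint x0) (spoint x))) = 0.
Proof.
set g := (fun x => _) => bg Vh h0.
have [q [qV bq]] := dual_basis.
have [Z VZ [reprZ Zm]] := zonal_kernel x0.
pose T p := l2inner S (ev p) g.
(* [z] is the Riesz representative in V of the pairing with the ridge. *)
pose z := \sum_i conjc (T (b i)) *: q i.
have Vz : V z by apply: solidharm_sum => i; exact: (solidharmZ _ (qV i)).
have reprz p : V p -> ip S p z = T p.
  move=> /b_span[c ->]; rewrite /z ip_sumr /T ev_sum l2inner_suml //; last first.
    by move=> *; exact: bm_ev.
  apply: eq_bigr => i _; rewrite ipZr conjcK evZ l2innerZl //; last exact: bm_ev.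
  rewrite mulrC; congr (_ * _); rewrite ip_suml (bigD1 i) //= ipZl bq eqxx mulr1.
  by rewrite big1 ?addr0 // => j ji; rewrite ipZl bq (negPf ji) mulr0.
(* Orthogonality to all rotations fixing [x0] becomes, by skew-adjointness, the invariance required
   by [zonal_eq0]. *)
have zonal p : V p -> (forall u v r, dotp u (spoint x0) = 0 ->
      dotp v (spoint x0) = 0 -> V r -> ip S (rotd (toC u) (toC v) r) p = 0) ->
    ev p x0 = 0 -> p = 0.
  move=> Vp pz p0.
  apply: (@zonal_eq0 _ _ (toC (spoint x0)) k) => //.
  - exact: sum_sqr_spoint.
  - exact: (proj1 Vp).
  - exact: (proj2 Vp).
  - have tE i : tangent (toC (spoint x0)) i =
        toC (delta_mx 0 i - spoint x0 0 i *: spoint x0).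
      by apply/rowP => j; rewrite !mxE rmorphB rmorphM rmorph_nat.
    have to0 i : dotp (delta_mx 0 i - spoint x0 0 i *: spoint x0) (spoint x0) = 0.
      rewrite dotpDl dotpNl dotpZl spoint_dotp mulr1 /dotp (bigD1 i) //= big1.
        by rewrite mxE !eqxx mul1r addr0 subrr.
      by move=> j /negPf ji; rewrite mxE ji mul0r.
    move=> i j; rewrite !tE.
    have Vr := solidharm_rotd (toC (delta_mx 0 i - spoint x0 0 i *: spoint x0))
      (toC (delta_mx 0 j - spoint x0 0 j *: spoint x0)) Vp.
    apply: (homog_ip_eq0 S_uniform (proj1 Vr)).
    by rewrite ip_rotd // ipC pz ?conjc0 ?oppr0.
  - by rewrite -evE.
have [m0|m0] := eqVneq m 0%N.
  have [c ->] := b_span Vh; rewrite big1 => [|i].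
    rewrite ev0 l2innerE -[RHS](cint_cst S 0); congr cint.
    by apply/funext => x; rewrite mul0r.
  by have := ltn_ord i; rewrite {2}m0.
(* Both [z] and [Z] are zonal about [x0], and Z(x0) = m makes this combination vanish there. *)
have zZ : m%:R *: z - ev z x0 *: Z = 0.
  apply: zonal.
  - exact: (solidharmB (solidharmZ _ Vz) (solidharmZ _ VZ)).
  - move=> u v r u0 v0 Vr; have VDr := solidharm_rotd (toC u) (toC v) Vr.
    have Du : ev (rotd (toC u) (toC v) r) x0 = 0.
      rewrite rotdE evB (evM (linmp (toC u))) (evM (linmp (toC v))) !ev_linmp u0 v0.
      by rewrite !mul0r subrr.
    have TD : T (rotd (toC u) (toC v) r) = 0.
      by have := @cint_rotd R n S S_uniform (spoint x0) (conjc \o phi) r u v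
        (bmC bg) u0 v0.
    by rewrite ipBr !ipZr (reprz _ VDr) (reprZ _ VDr) Du TD !mulr0 subrr.
  - by rewrite evB !evZ Zm mulrC subrr.
rewrite -[LHS]/(T h) -(reprz _ Vh); apply/eqP.
have : ip S h (m%:R *: z) = 0.
  have -> : m%:R *: z = ev z x0 *: Z by apply/eqP; rewrite -subr_eq0 zZ.
  by rewrite ipZr (reprZ _ Vh) h0 mulr0.
by rewrite ipZr conjc_nat => /eqP; rewrite mulf_eq0 pnatr_eq0 (negPf m0).
Qed.

(** [t] is the multiple of the kernel with the same value at [x0] as [h], so ridges do not
    distinguish them. Its squared norm is |h(x0)|^2 / m: this is the gain that offsets the dimension
    factor in the sup-norm hypothesis. *)
Lemma zonal_average x0 h : V h -> exists t, [/\ V t,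
  L2 S (ev t) ^+ 2 * m%:R = normc (ev h x0) ^+ 2 &
  forall phi : R -> R[i], bm (fun x => phi (dotp (spoint x0) (spoint x))) ->
    l2inner S (ev t) (fun x => phi (dotp (spoint x0) (spoint x))) =
    l2inner S (ev h) (fun x => phi (dotp (spoint x0) (spoint x)))].
Proof.
move=> Vh; have [m0|m0] := eqVneq m 0%N.
  have h0 : h = 0.
    have [c ->] := b_span Vh; rewrite big1 // => i.
    by have := ltn_ord i; rewrite {2}m0.
  exists 0; rewrite h0; split; [exact: solidharm0| |by []].
  by rewrite m0 mulr0 ev0 ComplexField.Normc.normc0 expr0n.
have [Z VZ [reprZ Zm]] := zonal_kernel x0.
have mC0 : m%:R != 0 :> R[i] by rewrite pnatr_eq0.
pose a := ev h x0 / m%:R.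
have Vt : V (a *: Z) by exact: solidharmZ.
exists (a *: Z); split; first exact: Vt.
  have -> : L2 S (ev (a *: Z)) ^+ 2 = normc a ^+ 2 * m%:R.
    apply: complexI; rewrite -l2inner_self; last exact: bm_ev.
    rewrite -[LHS]/(ip S (a *: Z) (a *: Z)) ipZl ipZr (reprZ _ VZ) Zm.
    by rewrite mulrA mul_conjc [RHS]rmorphM; congr (_ * _); rewrite rmorph_nat.
  have -> : normc (ev h x0) = normc a * m%:R.
    rewrite -[m%:R]ger0_norm // -normc_real -normcM rmorph_nat.
    by rewrite /a divfK.
  by rewrite exprMn -mulrA -expr2.
move=> phi bphi; have Vd : V (h - a *: Z) by exact: (solidharmB Vh Vt).
have := l2inner_ridge_eq0 bphi Vd; rewrite evB evZ Zm /a divfK // subrr => /(_ erefl).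
rewrite l2innerBl //; [|exact: bm_ev|by apply: bmZ; exact: bm_ev].
by move=> /eqP; rewrite subr_eq0 => /eqP ->.
Qed.

End ReproducingKernel.

(** * Projections onto a band of degrees *)

Section HarmonicComponents.
Context (R : realType) (n : nat) (S : probability (sphere R n) R)
  (S_uniform : uniform_sphere S) (n_gt1 : (1 < n)%N).
Implicit Types (k : nat) (h p t : mpoly n.+1 R[i]) (x : sphere R n).

Lemma harmonicsP k (f : sphere R n -> R[i]) :
  harmonics k f <-> exists2 p, solidharm k p & f = ev p.
Proof.
split=> [[p [pk Lp fp]]|[p [pk Lp] ->]]; exists p.
- by split.
- by apply/funext => x; rewrite fp evE; apply: meval_eq => i; rewrite mxE.
- by split=> // x; rewrite evE; apply: meval_eq => i; rewrite mxE.
Qed.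

(** A nonzero [cdim] is not the default value, so it comes with a basis of functions. Injectivity of
    restriction lifts it to a basis of polynomials; uniqueness of coefficients gives freeness. *)
Lemma zonal_average_cdim k x0 h : solidharm k h ->
  cdim (@harmonics R n k) != 0%N -> exists t, [/\ solidharm k t,
  L2 S (ev t) ^+ 2 * (cdim (@harmonics R n k))%:R = normc (ev h x0) ^+ 2 &
  forall phi : R -> R[i], bm (fun x => phi (dotp (spoint x0) (spoint x))) ->
    l2inner S (ev t) (fun x => phi (dotp (spoint x0) (spoint x))) =
    l2inner S (ev h) (fun x => phi (dotp (spoint x0) (spoint x)))].
Proof.
move=> Vh; rewrite /cdim; case: xgetP => [m mE [e [eH eB]]|_]; last by rewrite eqxx.
move=> _; have /choice[b bP] : forall i, exists p, solidharm k p /\ e i = ev p.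
  by move=> i; have /harmonicsP[p Vp ep] := eH i; exists p.
have bV i := proj1 (bP i).
have sumE (c : 'rV[R[i]]_m) :
    ev (\sum_i c 0 i *: b i) = fun x => \sum_i c 0 i * e i x.
  apply/funext => x; rewrite ev_sum; apply: eq_bigr => i _.
  by rewrite evZ (proj2 (bP i)).
have ev_inj p : solidharm k p -> (forall x, ev p x = 0) -> p = 0.
  move=> [pk _] p0; apply: (homog_ip_eq0 S_uniform pk).
  rewrite /ip (_ : ev p = ev 0) -?[LHS]/(ip S 0 0) ?ip0l //.
  by apply/funext => x; rewrite ev0 p0.
have b_span p : solidharm k p -> exists c : 'rV[R[i]]_m, p = \sum_i c 0 i *: b i.
  move=> Vp; have /eB[c [cP _]] : harmonics k (ev p).
    by apply/harmonicsP; exact: (ex_intro2 _ _ p Vp erefl).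
  have Vs : solidharm k (\sum_i c 0 i *: b i).
    by apply: solidharm_sum => i; exact: (solidharmZ _ (bV i)).
  exists c; apply/eqP; rewrite -subr_eq0; apply/eqP.
  apply: (ev_inj _ (solidharmB Vp Vs)) => x.
  by rewrite evB sumE cP subrr.
have b_free (c : 'rV[R[i]]_m) : \sum_i c 0 i *: b i = 0 -> c = 0.
  move=> c0.
  have /eB[d [_ du]] : harmonics k (ev (0 : mpoly n.+1 R[i])).
    by apply/harmonicsP; exact: (ex_intro2 _ _ 0 (solidharm0 _ _ _) erefl).
  transitivity d; [symmetry|]; apply: du => x; first by rewrite -c0 sumE.
  by rewrite ev0 big1 // => i _; rewrite mxE mul0r.
exact: (zonal_average S_uniform n_gt1 bV b_span b_free x0 Vh).
Qed.

(** For a genuine projection the last equality is its orthogonality tested on itself; the default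
    value is the zero polynomial. *)
Lemma hproj_ev (f : sphere R n -> R[i]) k : bm f -> exists h, [/\ solidharm k h,
  hproj S k f = ev h & l2inner S f (ev h) = l2inner S (ev h) (ev h)].
Proof.
move=> bf; rewrite /hproj; case: xgetP => [g gE [/harmonicsP[p Vp gp] fgh]|_].
  exists p; split; [exact: Vp|by rewrite gp|].
  have /fgh : harmonics k (ev p).
    by apply/harmonicsP; exact: (ex_intro2 _ _ p Vp erefl).
  rewrite gp l2innerBl //; try exact: bm_ev.
  by move=> /eqP; rewrite subr_eq0 => /eqP.
exists 0; split; [exact: solidharm0|by rewrite ev0|].
rewrite ev0 l2innerE [RHS]l2innerE; congr cint; apply/funext => x.
by rewrite conjc0 !mulr0.
Qed.

Context (f : sphere R n -> R[i]) (bf : bm f) (J : set nat) (c : nat -> R)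
  (c_ge0 : forall k, J k -> 0 <= c k)
  (f_le : forall k, J k -> forall x, normc (hproj S k f x) <=
     c k * Num.sqrt (cdim (@harmonics R n k))%:R * L2 S f).

Definition partial_proj (m : nat) (x : sphere R n) : R[i] :=
  \sum_(k < m | `[< J k >]) hproj S k f x.

Lemma bm_hproj k : bm (hproj S k f).
Proof. by have [h [_ -> _]] := hproj_ev k bf; exact: bm_ev. Qed.

Lemma bm_partial_proj m : bm (partial_proj m).
Proof. by apply: bm_sum => k _; exact: bm_hproj. Qed.

Lemma L2_sum_orthogonal m (P : pred 'I_m) (t : nat -> mpoly n.+1 R[i]) :
  (forall k, solidharm k (t k)) ->
  L2 S (fun x => \sum_(k < m | P k) ev (t k) x) ^+ 2 =
  \sum_(k < m | P k) L2 S (ev (t k)) ^+ 2.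
Proof.
move=> Vt; apply: complexI; rewrite -l2inner_self; last first.
  by apply: bm_sum => k _; exact: bm_ev.
rewrite rmorph_sum -ev_sum -[LHS]/(ip S _ _) ip_suml; apply: eq_bigr => k Pk.
transitivity (ip S (t k) (t k)); last exact: l2inner_self (bm_ev _).
rewrite ip_sumr (bigD1 k) //= big1 ?addr0 // => j /andP[_ jk].
by apply: (ip_orthogonal S_uniform (ltnW n_gt1) _ (Vt k) (Vt j)); rewrite eq_sym.
Qed.

(** Each f_k is replaced by its zonal average about [x0], of norm at most c_k ||f||, with the same
    pairing with the ridge. Orthogonality of degrees bounds the norm of the sum of averages, and a
    single Cauchy-Schwarz with the whole ridge concludes. *)
Lemma ridge_bound x0 (phi : R -> R[i]) m :
  bm (fun x => phi (dotp (spoint x0) (spoint x))) ->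
  normc (l2inner S (partial_proj m) (fun x => phi (dotp (spoint x0) (spoint x)))) <=
  Num.sqrt (\sum_(k < m | `[< J k >]) c k ^+ 2) * L2 S f
    * L2 S (fun x => phi (dotp (spoint x0) (spoint x))).
Proof.
set g := (fun x => _) => bg.
have /choice[t tP] : forall k, exists t, solidharm k t /\ (J k ->
    L2 S (ev t) ^+ 2 <= (c k * L2 S f) ^+ 2 /\
    l2inner S (ev t) g = l2inner S (hproj S k f) g).
  move=> k; have [Jk|nJk] := pselect (J k); last first.
    by exists 0; split=> //; exact: solidharm0.
  have [h [Vh hE _]] := hproj_ev k bf.
  (* When [cdim] is 0 the sup-norm bound forces f_k = 0, and the zero polynomial serves as
     average. *)
  have [m0|m0] := eqVneq (cdim (@harmonics R n k)) 0%N.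
    have h0 x : ev h x = 0.
      apply: ComplexField.Normc.eq0_normc; apply/eqP.
      rewrite eq_le normc_ge0 andbT -hE (le_trans (f_le Jk x)) //.
      by rewrite m0 sqrtr0 mulr0 mul0r.
    exists 0; split; [exact: solidharm0|move=> _].
    have -> : hproj S k f = ev 0 by rewrite hE; apply/funext => x; rewrite h0 ev0.
    split=> //; rewrite (_ : L2 S (ev 0) = 0) ?expr0n ?sqr_ge0 //.
    by rewrite /L2 -[l2inner _ _ _]/(ip S 0 0) ip0l sqrtr0.
  have [t [Vt tn tg]] := zonal_average_cdim x0 Vh m0.
  exists t; split=> // _; split; last by rewrite hE; exact: tg.
  have m1 : 0 < (cdim (@harmonics R n k))%:R :> R by rewrite ltr0n lt0n.
  rewrite -(ler_pM2r m1) tn -hE -[X in _ * X](sqr_sqrtr (ltW m1)) -exprMn mulrAC.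
  by rewrite lerXn2r ?nnegrE ?normc_ge0 ?mulr_ge0 ?sqrtr_ge0 ?L2_ge0 ?c_ge0 // f_le.
have -> : l2inner S (partial_proj m) g =
    l2inner S (fun x => \sum_(k < m | `[< J k >]) ev (t k) x) g.
  rewrite !l2inner_suml //; [|by move=> *; exact: bm_ev|by move=> *; exact: bm_hproj].
  by apply: eq_bigr => k /asboolP Jk; have [_ /(_ Jk)[]] := tP k.
have bt : bm (fun x => \sum_(k < m | `[< J k >]) ev (t k) x).
  by apply: bm_sum => k _; exact: bm_ev.
apply: (le_trans (l2inner_cauchy S bt bg)); rewrite ler_wpM2r ?L2_ge0 //.
rewrite -(@ler_pXn2r _ 2) ?nnegrE ?mulr_ge0 ?L2_ge0 ?sqrtr_ge0 //.
rewrite L2_sum_orthogonal; last by move=> k; have [] := tP k.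
rewrite exprMn sqr_sqrtr ?sumr_ge0 //; last by move=> *; exact: sqr_ge0.
rewrite mulr_suml ler_sum // => k /asboolP Jk; rewrite -exprMn.
by have [_ /(_ Jk)[]] := tP k.
Qed.

Lemma L2_partial_proj m :
  l2inner S f (partial_proj m) = (L2 S (partial_proj m) ^+ 2)%:C%C.
Proof.
have /choice[h hP] : forall k, exists h, [/\ solidharm k h,
  hproj S k f = ev h & l2inner S f (ev h) = l2inner S (ev h) (ev h)].
  by move=> k; exact: hproj_ev.
have -> : partial_proj m = fun x => \sum_(k < m | `[< J k >]) ev (h k) x.
  by apply/funext => x; apply: eq_bigr => k _; have [_ -> _] := hP k.
rewrite L2_sum_orthogonal; last by move=> k; have [] := hP k.
rewrite l2inner_sumr //; last by move=> *; exact: bm_ev.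
rewrite rmorph_sum; apply: eq_bigr => k _; have [_ _ ->] := hP k.
by rewrite l2inner_self //; exact: bm_ev.
Qed.

End HarmonicComponents.

(** * Networks against a band of harmonics *)

Section NetworkBound.
Context (R : realType) (n : nat) (S : probability (sphere R n) R)
  (S_uniform : uniform_sphere S) (n_gt1 : (1 < n)%N).
Context (f : sphere R n -> R[i]) (bf : bm f) (J : set nat) (c : nat -> R)
  (c_ge0 : forall k, J k -> 0 <= c k)
  (f_le : forall k, J k -> forall x, normc (hproj S k f x) <=
     c k * Num.sqrt (cdim (@harmonics R n k))%:R * L2 S f).
Context (sigma : R -> R) (L : R) (L_ge0 : 0 <= L)
  (sigma_lip : forall s t, `|sigma s - sigma t| <= L * `|s - t|).
Implicit Types (x : sphere R n) (v : 'rV[R]_n.+1).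

Lemma normc_conj (z : R[i]) : normc (conjc z) = normc z.
Proof. by rewrite !normcE2; case: z => a b /=; rewrite sqrrN. Qed.

Lemma row_direction v : exists s (x0 : sphere R n), v = s *: spoint x0.
Proof.
have [->|/row_normalize[s [w [-> ww _]]]] := eqVneq v 0.
  by exists 0, (SigSub (sphere_point_subproof R n)); rewrite scale0r.
by exists s, (SigSub (mem_set ww : w \in [set y : 'rV[R]_n.+1 | dotp y y = 1])).
Qed.

Lemma normr_dotp_spoint v x : `|dotp v (spoint x)| <= n.+1%:R * `|v|.
Proof.
rewrite (le_trans (ler_norm_sum _ _ _)) //.
have -> : n.+1%:R * `|v| = \sum_(i < n.+1) `|v|.
  by rewrite sumr_const card_ord mulr_natl.
rewrite ler_sum // => i _; rewrite normrM -[leRHS]mulr1 ler_pM //; last exact: spoint_coord_le1.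
rewrite /Num.norm /= mx_normrE.
exact: (le_bigmax _ (fun ij : 'I_1 * 'I_n.+1 => `|v ij.1 ij.2|) (0, i)).
Qed.

(** Centering makes the Lipschitz bound independent of the bias [s]. *)
Definition ridge v (s : R) (x : sphere R n) : R[i] :=
  (sigma (dotp v (spoint x) + s) - sigma s)%:C%C.

Lemma ridge_le v s x : normc (ridge v s x) <= L * (n.+1%:R * `|v|).
Proof.
rewrite normc_real (le_trans (sigma_lip _ _)) // ler_wpM2l // addrK.
exact: normr_dotp_spoint.
Qed.

Lemma sigma_measurable : measurable_fun setT sigma.
Proof.
apply: continuous_measurable_fun => t; apply/cvgrPdist_le => e e0.
have L1 : 0 < L + 1 by rewrite ltr_wpDl.
near=> s; rewrite (le_trans (sigma_lip _ _)) //.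
rewrite (@le_trans _ _ ((L + 1) * `|t - s|)) // ?ler_wpM2r ?lerDl //.
rewrite mulrC -ler_pdivlMr //; near: s.
by apply: cvgr_dist_le; [exact: cvg_id|rewrite divr_gt0].
Unshelve. all: by end_near. Qed.

Lemma bm_ridge v s : bm (ridge v s).
Proof.
split; last exact: bmr_cst.
split; last by exists (L * (n.+1%:R * `|v|)) => x; rewrite -normc_real; exact: ridge_le.
have [[md _] _] := bm_ev (linmp (map_mx (real_complex R) v)).
apply: measurable_funB => //.
apply: (measurableT_comp sigma_measurable); apply: measurable_funD => //.
by apply: eq_measurable_fun md => x _; rewrite ev_linmp.
Qed.

Lemma ridge_proj_bound v s m :
  normc (l2inner S (partial_proj S f J m) (ridge v s)) <=
  Num.sqrt (\sum_(k < m | `[< J k >]) c k ^+ 2) * L2 S f * (L * (n.+1%:R * `|v|)).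
Proof.
have [t [x0 vE]] := row_direction v.
pose phi (y : R) := (sigma (t * y + s) - sigma s)%:C%C.
have rE : ridge v s = fun x => phi (dotp (spoint x0) (spoint x)).
  by apply/funext => x; rewrite /ridge vE dotpZl.
have br := bm_ridge v s.
rewrite {1}rE (le_trans (ridge_bound S_uniform n_gt1 bf c_ge0 f_le m _)) -?rE //.
apply: ler_wpM2l; first by rewrite mulr_ge0 ?sqrtr_ge0 ?L2_ge0.
by apply: L2_le_bound => //; [rewrite !mulr_ge0|move=> x; exact: ridge_le].
Qed.

(** A constant is a ridge function about any pole. *)
Lemma cst_proj_bound m :
  normc (l2inner S (partial_proj S f J m) (fun=> 1)) <=
  Num.sqrt (\sum_(k < m | `[< J k >]) c k ^+ 2) * L2 S f.
Proof.
have b1 : bm (fun x : sphere R n => 1 : R[i]) by exact: bm_cst.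
have := @ridge_bound R n S S_uniform n_gt1 f bf J c c_ge0 f_le
  (SigSub (sphere_point_subproof R n)) (fun=> 1) m b1.
move=> /le_trans; apply; rewrite -[leRHS]mulr1.
apply: ler_wpM2l; first by rewrite mulr_ge0 ?sqrtr_ge0 ?L2_ge0.
by apply: L2_le_bound => // x; rewrite ComplexField.Normc.normc1.
Qed.

(** With s the partial projection, ||s||^2 = <s, f>, and f = r + g + C, where r is the error, g the
    sum of centered units and C the collected constants. Cauchy-Schwarz handles r. With G = L (n +
    1) W, the units contribute a coefficient N W G and C at most B + delta + N W G, whence the
    factor 2. *)
Lemma network_proj_bound (N : nat) (u : 'I_N -> R[i]) (a : 'I_N -> 'rV[R]_n.+1)
    (b : 'I_N -> R) (delta B W : R) m :
  0 <= delta -> max_weight u a <= W ->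
  (forall x, normc (f x - network sigma u a b x) <= delta) ->
  (forall x, normc (f x) <= B) ->
  L2 S (partial_proj S f J m) ^+ 2 <= delta * L2 S (partial_proj S f J m)
    + (B + delta + 2 * (N%:R * (W * (L * (n.+1%:R * W)))))
      * (Num.sqrt (\sum_(k < m | `[< J k >]) c k ^+ 2) * L2 S f).
Proof.
move=> delta0 uaW rd fB; set s := partial_proj S f J m.
have bs : bm s by exact: bm_partial_proj.
set E := (Num.sqrt _ * _).
have E0 : 0 <= E by rewrite mulr_ge0 ?sqrtr_ge0 ?L2_ge0.
have uW j : normc (u j) <= W.
  apply: le_trans uaW; rewrite /max_weight le_max; apply/orP; right.
  exact: (le_bigmax _ (fun j => normc (u j)) j).
have aW j : `|a j| <= W.
  apply: le_trans uaW; rewrite /max_weight le_max; apply/orP; left.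
  exact: (le_bigmax _ (fun j => `|a j|) j).
have W0 : 0 <= W.
  apply: le_trans uaW; rewrite /max_weight le_max; apply/orP; left.
  exact: bigmax_ge_id.
pose G := L * (n.+1%:R * W).
have G0 : 0 <= G by rewrite !mulr_ge0.
have aG j : L * (n.+1%:R * `|a j|) <= G by rewrite !ler_wpM2l.
pose C := \sum_(j < N) u j * (sigma (b j))%:C%C.
pose r x := f x - network sigma u a b x.
pose g x := \sum_(j < N) u j * ridge (a j) (b j) x.
have bg : bm g by apply: bm_sum => j _; apply: bmZ; exact: bm_ridge.
have netE x : network sigma u a b x = g x + C.
  rewrite -big_split; apply: eq_bigr => j _ /=.
  by rewrite -mulrDr /ridge rmorphB subrK.
have bC : bm (fun x : sphere R n => C) by exact: bm_cst.
have br : bm r.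
  have := bmB bf (bmD bg bC); congr bm; apply/funext => x.
  by rewrite /r netE.
have fE : f = fun x => r x + (g x + C).
  by apply/funext => x; rewrite -netE /r subrK.
have normc_sum (T : Type) (l : seq T) (P : pred T) (F : T -> R[i]) :
    normc (\sum_(j <- l | P j) F j) <= \sum_(j <- l | P j) normc (F j).
  elim: l => [|j l IH]; first by rewrite !big_nil ComplexField.Normc.normc0.
  rewrite !big_cons; case: (P j) => //.
  by rewrite (le_trans (le_normcD _ _)) // lerD2l.
have gB x : normc (g x) <= N%:R * (W * G).
  rewrite (le_trans (normc_sum _ _ _ _)) //.
  have -> : N%:R * (W * G) = \sum_(j < N) W * G.
    by rewrite sumr_const card_ord mulr_natl.
  rewrite ler_sum // => j _; rewrite normcM ler_pM ?normc_ge0 //.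
  by rewrite (le_trans (ridge_le _ _ _)).
(* The biases are unrestricted, so [C] is estimated as f - r - g at one point of the sphere. *)
have CB : normc C <= B + delta + N%:R * (W * G).
  have x0 : sphere R n := SigSub (sphere_point_subproof R n).
  have -> : C = f x0 + (- r x0 + - g x0) by rewrite fE; ring.
  rewrite (le_trans (le_normcD _ _)) // -addrA lerD //.
  by rewrite (le_trans (le_normcD _ _)) // !normcN lerD //; exact: rd.
have sE : L2 S s ^+ 2 = normc (l2inner S s f).
  rewrite (l2innerC S bf bs) L2_partial_proj // conjc_real normc_real.
  by rewrite ger0_norm ?sqr_ge0.
have b1 : bm (fun x : sphere R n => 1 : R[i]) by exact: bm_cst.
have E3 : l2inner S s (fun=> C) = conjc C * l2inner S s (fun=> 1).
  rewrite -(l2innerZr S C b1 bs); congr l2inner.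
  by apply/funext => x; rewrite mulr1.
have := congr1 (l2inner S s) fE.
rewrite (l2innerDr S br (bmD bg bC) bs) (l2innerDr S bg bC bs) E3 => sfE.
rewrite sE sfE.
rewrite (le_trans (le_normcD _ _)) // lerD //.
  rewrite (le_trans (l2inner_cauchy S bs br)) // mulrC ler_wpM2r ?L2_ge0 //.
  exact: L2_le_bound.
rewrite (le_trans (le_normcD _ _)) //.
have -> : B + delta + 2 * (N%:R * (W * (L * (n.+1%:R * W)))) =
  N%:R * (W * G) + (B + delta + N%:R * (W * G)) by rewrite /G; ring.
rewrite mulrDl lerD //.
  rewrite l2inner_sumr //; last by move=> j _; apply: bmZ; exact: bm_ridge.
  rewrite (le_trans (normc_sum _ _ _ _)) //.
  have -> : N%:R * (W * G) * E = \sum_(j < N) W * (E * G).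
    by rewrite sumr_const card_ord -mulr_natl; ring.
  rewrite ler_sum // => j _.
  rewrite l2innerZr //; last exact: bm_ridge.
  rewrite normcM normc_conj ler_pM ?normc_ge0 //.
  by rewrite (le_trans (ridge_proj_bound _ _ _)) // -/E ler_wpM2l.
rewrite normcM normc_conj ler_pM ?normc_ge0 //.
exact: cst_proj_bound.
Qed.

End NetworkBound.

(** * The inequality in a fixed dimension *)

Section DimensionBound.
Context (R : realType) (n : nat) (S : probability (sphere R n) R)
  (S_uniform : uniform_sphere S) (n_gt1 : (1 < n)%N).
Implicit Types (f : sphere R n -> R[i]).

Lemma ccontinuous_measurable f : ccontinuous f ->
  measurable_fun setT (fun x => complex.Re (f x)) /\
  measurable_fun setT (fun x => complex.Im (f x)).
Proof.
move=> fc; have near_f x (e : R) : 0 < e -> \forall y \near x, normc (f x - f y) < e.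
  move=> e0; have FF : Filter (nbhs x) by exact: nbhs_filter.
  have /(@pseudometric_normed_Zmodule.cvgrPdist_lt _ _ _ _ FF) := fc x.
  (* The norm on [R[i]^o] takes values in R[i], so the radius is embedded there. *)
  move=> /(_ e%:C%C).
  rewrite ltcR => /(_ e0); apply: filterS => y.
  by rewrite -ltcR.
have meas (g : R[i] -> R) : (forall z w, `|g z - g w| <= normc (z - w)) ->
    measurable_fun setT (fun x => g (f x)).
  move=> g_lip; apply: continuous_measurable_sphere => x.
  have FF : Filter (nbhs x) by exact: nbhs_filter.
  apply/(@pseudometric_normed_Zmodule.cvgrPdist_lt _ _ _ _ FF) => e e0.
  have := near_f x e e0; apply: filterS => y; apply: le_lt_trans.
  exact: g_lip.
split; apply: meas => z w.
  by rewrite (le_trans _ (Re_le_normc _)) //; case: z w => [p q] [p' q'].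
by rewrite (le_trans _ (Im_le_normc _)) //; case: z w => [p q] [p' q'].
Qed.

Lemma supnorm_leP f (e : \bar R) :
  (supnorm f <= e)%E -> forall x, ((normc (f x))%:E <= e)%E.
Proof. by move=> fe x; apply: le_trans fe; apply: ereal_sup_ubound; exists x. Qed.

Lemma bm_ccontinuous f (C : R) :
  ccontinuous f -> (forall x, normc (f x) <= C) -> bm f.
Proof.
move=> /ccontinuous_measurable[mr mi] fC; split; split => //.
  by exists C => x; rewrite (le_trans (Re_le_normc _)).
by exists C => x; rewrite (le_trans (Im_le_normc _)).
Qed.

Lemma normc_le_fine_supnorm f : bm f -> forall x, normc (f x) <= fine (supnorm f).
Proof.
move=> bf x; have [C C0 fC] := bm_bounded bf.
have le_sup := supnorm_leP (lexx (supnorm f)).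
have sC : (supnorm f <= C%:E)%E.
  by apply: ge_ereal_sup => _ [y _ <-]; rewrite lee_fin.
have s_fin : supnorm f \is a fin_num.
  rewrite fin_numE; apply/andP; split.
    by rewrite -ltNye (lt_le_trans _ (le_sup x)) // ltNyr.
  by rewrite -ltey (le_lt_trans sC) // ltry.
by rewrite -lee_fin fineK.
Qed.

Context (sigma : R -> R) (L : R) (L_ge0 : 0 <= L)
  (sigma_lip : forall s t, `|sigma s - sigma t| <= L * `|s - t|).

Lemma bm_network (N : nat) (u : 'I_N -> R[i]) (a : 'I_N -> 'rV[R]_n.+1)
  (b : 'I_N -> R) : bm (network sigma u a b).
Proof.
apply: bm_sum => j _; apply: bmZ.
have := bmD (bm_ridge L_ge0 sigma_lip (a j) (b j)) (bm_cst n (sigma (b j))%:C%C).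
by congr bm; apply/funext => x; rewrite /ridge rmorphB subrK.
Qed.

Lemma esum_partial_le (J : set nat) (c : nat -> R) (E : R) m :
  ((\esum_(k in J) (c k ^+ 2)%:E) `^ 2^-1 <= E%:E)%E ->
  Num.sqrt (\sum_(k < m | `[< J k >]) c k ^+ 2) <= E.
Proof.
move=> cE; rewrite -lee_fin; apply: le_trans cE.
have s0 : 0 <= \sum_(k < m | `[< J k >]) c k ^+ 2.
  by apply: sumr_ge0 => k _; exact: sqr_ge0.
rewrite -powR12_sqrt // -poweR_EFin.
have le : ((\sum_(k < m | `[< J k >]) c k ^+ 2)%:E <= \esum_(k in J) (c k ^+ 2)%:E)%E.
  have JE : J = [set k | `[< J k >]].
    by apply/seteqP; split=> k /= /asboolP.
  rewrite [X in (_ <= esum X _)%E]JE -nneseries_esum => [|k _]; last by rewrite lee_fin sqr_ge0.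
  apply: le_trans (nneseries_lim_ge m _); last by move=> k _; rewrite lee_fin sqr_ge0.
  by rewrite -sumEFin big_mkord.
apply: gt0_ler_poweR => //.
- by rewrite in_itv /= lee_fin s0 leey.
- by rewrite in_itv /= leey andbT (le_trans _ le) // lee_fin.
Qed.

(** Some partial sum s has at least half the norm of the band projection, so ||f|| <= 2 |C1| ||s||.
    Dividing [network_proj_bound] by ||s|| bounds ||s||, and the ratio ||f|| / ||s|| left over is
    again at most 2 |C1|. The absolute value appears because [C1] may have any sign. *)
Lemma dimension_bound f (J : set nat) (c : nat -> R) (C1 E delta X B : R)
    (N : nat) (u : 'I_N -> R[i]) (a : 'I_N -> 'rV[R]_n.+1) (b : 'I_N -> R) :
  ccontinuous f ->
  (l2norm S f <= C1%:E * l2norm S (band_proj S J f))%E ->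
  (forall k, J k -> 0 <= c k) ->
  (forall k, J k -> (supnorm (hproj S k f)
     <= (c k * Num.sqrt (cdim (@harmonics R n k))%:R)%:E * l2norm S f)%E) ->
  ((\esum_(k in J) (c k ^+ 2)%:E) `^ 2^-1 <= E%:E)%E ->
  0 < delta ->
  (supnorm (fun x => f x - network sigma u a b x)%R <= delta%:E)%E ->
  N%:R <= X -> max_weight u a <= X ->
  fine (supnorm f) <= B -> 0 < fine (l2norm S f) ->
  fine (l2norm S f) <= 2 * `|C1| * (delta
     + (B + delta + 2 * (X * (X * (L * (n.+1%:R * X))))) * (E * (2 * `|C1|))).
Proof.
move=> fc fP c0 hc cE delta0 fnet NX aX fB F0.
have netB x : normc (f x - network sigma u a b x) <= delta.
  by rewrite -lee_fin; exact: (supnorm_leP fnet).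
have bnet := bm_network u a b.
have [Cn Cn0 netC] := bm_bounded bnet.
(* [f] is within [delta] of a network, which is bounded on the sphere. *)
have bf : bm f.
  apply: (bm_ccontinuous (C := delta + Cn) fc) => x.
  rewrite -[f x](subrK (network sigma u a b x)).
  by rewrite (le_trans (le_normcD _ _)) // lerD.
have fleB x : normc (f x) <= B by apply: le_trans fB; exact: normc_le_fine_supnorm.
move: fP F0; rewrite l2normE //= => fP F0.
have f_le k : J k -> forall x, normc (hproj S k f x) <=
    c k * Num.sqrt (cdim (@harmonics R n k))%:R * L2 S f.
  move=> Jk x; rewrite -lee_fin EFinM -l2normE //.
  exact: (supnorm_leP (hc k Jk)).
have X0 : 0 <= X by apply: le_trans NX.
have l2cst0 : l2norm S (fun=> 0) = 0%E.
  have b0 : bm (fun x : sphere R n => 0 : R[i]) by exact: bm_cst.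
  by rewrite l2normE // /L2 l2innerE (_ : (fun x => _) = fun=> 0) ?cint_cst ?sqrtr0 //;
    apply/funext => x; rewrite mul0r.
have [P0|[m Pm]] : l2norm S (band_proj S J f) = 0%E \/
    exists m, (l2norm S (band_proj S J f) <= (2 * L2 S (partial_proj S f J m))%:E)%E.
  rewrite /band_proj; case: xgetP => [P _ [PL2 Pcvg]|_]; last by left.
  have [P0|] := eqVneq (l2norm S P) 0%E; [by left|right].
  apply: (l2norm_approx (s := partial_proj S f J) PL2) => //.
    by move=> m; exact: bm_partial_proj.
  by rewrite lt_def; apply/andP; split => //; exact: Lnorm_ge0.
  by move: fP; rewrite P0 mule0 lee_fin leNgt F0.
set s := partial_proj S f J m in Pm *.
have Fs : L2 S f <= 2 * `|C1| * L2 S s.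
  rewrite -lee_fin (le_trans fP) //.
  rewrite (@le_trans _ _ (`|C1|%:E * l2norm S (band_proj S J f))%E) //.
    by apply: lee_wpmul2r; [exact: Lnorm_ge0|rewrite lee_fin ler_norm].
  have -> : 2 * `|C1| * L2 S s = `|C1| * (2 * L2 S s) by ring.
  by rewrite EFinM lee_wpmul2l // lee_fin.
have s0 : 0 < L2 S s.
  rewrite lt_def L2_ge0 andbT; apply/eqP => s0.
  by move: Fs; rewrite s0 mulr0 leNgt F0.
have cE' := esum_partial_le m cE.
have := network_proj_bound S_uniform n_gt1 bf c0 f_le L_ge0 sigma_lip m
  (ltW delta0) aX netB fleB.
rewrite -/s => key.
apply: (le_trans Fs); apply: ler_wpM2l; first by rewrite mulr_ge0.
rewrite -(ler_pM2r s0) -expr2 (le_trans key) // [X in _ <= X]mulrDl lerD2l.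
rewrite -[X in _ <= X]mulrA.
have G0 : 0 <= L * (n.+1%:R * X) by rewrite !mulr_ge0.
have B0 : 0 <= B.
  exact: le_trans (normc_ge0 _) (fleB (SigSub (sphere_point_subproof R n))).
apply: ler_pM.
- by rewrite !addr_ge0 ?mulr_ge0 ?(ltW delta0).
- by rewrite mulr_ge0 ?sqrtr_ge0 ?L2_ge0.
- by rewrite lerD2l ler_wpM2l // ler_wpM2r // mulr_ge0.
- by rewrite -mulrA; apply: ler_pM; rewrite ?sqrtr_ge0 ?L2_ge0.
Qed.

End DimensionBound.

(** * Exponential decay against polynomial growth *)

Section Asymptotics.
Context (R : realType).

(** For q + 1 >= (E + 1) / alpha, the bound exp y >= (y / (q + 1))^(q + 1) at y = -ln(eps) D^alpha
    dominates D^(E + 1) up to the constant [K]. *)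
Lemma powR_exp_decay (E alpha eps : R) : 0 < alpha -> 0 < eps < 1 ->
  exists2 K : R, 0 <= K &
    forall D, 1 <= D -> D `^ E * eps `^ (D `^ alpha) <= K / D.
Proof.
move=> alpha0 /andP[eps0 eps1].
have [q hq] : exists q : nat, (E + 1) / alpha <= q.+1%:R.
  exists (Num.bound `|(E + 1) / alpha|).
  rewrite (le_trans (ler_norm _)) // (le_trans (ltW (archi_boundP _))) //.
  by rewrite ler_nat.
pose la := - ln eps; have la0 : 0 < la by rewrite oppr_gt0 ln_lt0 // eps0.
have q0 : 0 < q.+1%:R :> R by rewrite ltr0n.
exists ((q.+1%:R / la) ^+ q.+1).
  by rewrite exprn_ge0 // divr_ge0 // ltW.
move=> D D1; have D0 : 0 < D by exact: lt_le_trans D1.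
have y0 : 0 < D `^ alpha by rewrite powR_gt0.
have epsE : eps `^ (D `^ alpha) = (expR (la * D `^ alpha))^-1.
  by rewrite /powR (gt_eqF eps0) -expRN /la mulNr opprK mulrC.
have exp_ge : (la * D `^ alpha / q.+1%:R) ^+ q.+1 <= expR (la * D `^ alpha).
  have -> : la * D `^ alpha = (la * D `^ alpha / q.+1%:R) * q.+1%:R.
    by rewrite divfK // gt_eqF.
  rewrite expRM_natr mulfK ?gt_eqF // lerXn2r ?nnegrE ?expR_ge0 //.
    by rewrite divr_ge0 ?mulr_ge0 // ltW.
  by rewrite (le_trans _ (expR_ge1Dx _)) // lerDr.
have pow_ge : D `^ E * D <= (D `^ alpha) ^+ q.+1.
  rewrite -powR_mulrn ?(ltW y0) // -powRrM.
  rewrite -{2}[D]powRr1 ?(ltW D0) // -powRD; last by rewrite (gt_eqF D0) implybT.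
  by rewrite ler_powR // mulrC -ler_pdivrMr.
rewrite epsE ler_pdivrMr ?expR_gt0 // mulrAC ler_pdivlMr //.
apply: (le_trans pow_ge).
have -> : (D `^ alpha) ^+ q.+1 =
    (q.+1%:R / la) ^+ q.+1 * (la * D `^ alpha / q.+1%:R) ^+ q.+1.
  rewrite -exprMn; congr (_ ^+ _); field.
  by rewrite !gt_eqF.
by rewrite ler_wpM2l // exprn_ge0 // divr_ge0 // ltW.
Qed.

(** After multiplication by D^M, the upper bound on [F] is at most the sum of 2 k1 D^(2M) delta = 2
    k1 / D, which dictates the exponent of [delta], and a polynomial times eps^(D^alpha), also of
    order 1 / D. The lower bound k4 D^(-M) excludes this for large D. *)
Lemma exponential_beats_polynomial (M alpha eps k1 k2 k3 k4 L A B : R) :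
  0 < M -> 0 < alpha -> 0 < eps < 1 -> 0 < k1 -> 0 < k2 -> 0 <= k3 -> 0 < k4 ->
  0 <= L -> 0 < A -> 0 < B ->
  exists D0 : R, forall D F C1 C2 : R, 1 <= D -> D0 < D ->
    k4 * D `^ (- M) <= F -> `|C1| <= k1 * D `^ M -> `|C2| <= k2 * D `^ M ->
    let delta := D `^ (- (2 * M + 1)) in
    let X := A * (D * delta^-1) `^ B in
    ~ F <= 2 * `|C1| * (delta + (k3 + delta + 2 * (X * (X * (L * (D * X)))))
         * ((eps `^ (D `^ alpha) * C2) * (2 * `|C1|))).
Proof.
move=> M0 alpha0 eps01 k10 k20 k30 k40 L0 A0 B0.
have eps0 : 0 < eps by case/andP: eps01.
(* The exponent collects M from each of the two |C1|, from C2 and from the multiplier D^M, then 1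
   from the dimension, and three times the exponent of D in X. *)
pose E := 4 * M + 1 + 3 * ((2 * M + 2) * B).
have [K K0 decay] := powR_exp_decay E alpha0 eps01.
(* With X = A Y, the product D Y^3 >= 1 majorizes the network factor up to [Kc], using delta <=
   1. *)
pose Kc := k3 + 1 + 2 * (L * A ^+ 3).
pose T := 2 * k1 + 4 * k1 ^+ 2 * k2 * Kc * K.
exists (T / k4) => D F C1 C2 D1 TD kF C1k C2k delta X; apply/negP; rewrite -ltNge.
have D0 : 0 < D by exact: lt_le_trans D1.
have Dn0 : D != 0 by rewrite gt_eqF.
have powD r s : D `^ (r + s) = D `^ r * D `^ s by rewrite powRD // Dn0 implybT.
set p := D `^ M in C1k C2k; have p0 : 0 < p by rewrite powR_gt0.
set eta := eps `^ _; have eta0 : 0 < eta by rewrite powR_gt0.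
pose Y := D `^ ((2 * M + 2) * B).
have XE : X = A * Y.
  rewrite /X /Y; congr (_ * _); rewrite -powRN opprK.
  rewrite -{1}[D]powRr1 ?(ltW D0) // -powD powRrM; congr (_ `^ _ `^ _).
  by ring.
have Y1 : 1 <= Y.
  rewrite /Y -[leLHS](powRr0 D) ler_powR // mulr_ge0 ?(ltW B0) // addr_ge0 // mulr_ge0 //.
  exact: ltW.
have p2d : p ^+ 2 * delta = D^-1.
  rewrite -powR_mulrn ?(ltW p0) // -powRrM -powD -powR_inv1 ?(ltW D0) //.
  by congr (_ `^ _); ring.
have d1 : delta <= 1.
  by rewrite /delta -[leRHS](powRr0 D) ler_powR // oppr_le0 addr_ge0 // mulr_ge0 // ltW.
have d0 : 0 < delta by rewrite powR_gt0.
have pE : p ^+ 4 * (D * Y ^+ 3) * eta <= K / D.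
  have -> : p ^+ 4 * (D * Y ^+ 3) = D `^ E; last exact: decay.
  have -> : p ^+ 4 = D `^ (M * 4) by rewrite powRrM powR_mulrn ?powR_ge0.
  have -> : Y ^+ 3 = D `^ ((2 * M + 2) * B * 3).
    by rewrite powRrM powR_mulrn ?powR_ge0.
  have -> r : D * D `^ r = D `^ (1 + r) by rewrite powD powRr1 // ltW.
  rewrite -powD.
  by congr (_ `^ _); rewrite /E; ring.
apply: lt_le_trans kF.
have pinv : D `^ (- M) = p^-1 by rewrite powRN.
rewrite pinv ltr_pdivlMr //.
have e1 : 1 <= D * Y ^+ 3.
  by rewrite -[1]mulr1 ler_pM // exprn_ege1.
have G : k3 + delta + 2 * (X * (X * (L * (D * X)))) <= Kc * (D * Y ^+ 3).
  rewrite XE /Kc !mulrDl; apply: lerD; first apply: lerD.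
  - by rewrite -[leLHS]mulr1 ler_wpM2l.
  - by rewrite mul1r (le_trans d1).
  - by rewrite le_eqVlt; apply/orP; left; apply/eqP; ring.
have A3 : 0 <= A ^+ 3 by rewrite exprn_ge0 // ltW.
have LA : 0 <= L * A ^+ 3 by exact: mulr_ge0.
have Kc0 : 0 <= Kc by rewrite addr_ge0 ?addr_ge0 ?(mulr_ge0 _ LA).
have X0 : 0 <= X by rewrite XE mulr_ge0 ?(ltW A0) // (le_trans _ Y1).
set W := k3 + delta + _ in G *.
have W0 : 0 <= W.
  have LDX : 0 <= L * (D * X) by exact: mulr_ge0 L0 (mulr_ge0 (ltW D0) X0).
  apply: addr_ge0; first exact: addr_ge0 k30 (ltW d0).
  exact: mulr_ge0 (ler0n _ 2) (mulr_ge0 X0 (mulr_ge0 X0 LDX)).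
apply: (@le_lt_trans _ _ (T / D)); last first.
  by rewrite ltr_pdivrMr // -ltr_pdivrMl // mulrC.
have c1 : 0 <= 2 * `|C1| by exact: mulr_ge0.
have c1k : 2 * `|C1| <= 2 * (k1 * p) by rewrite ler_wpM2l.
have q0 : 0 <= eta * `|C2| by exact: mulr_ge0 (ltW eta0) (normr_ge0 _).
have q1 : eta * `|C2| <= eta * (k2 * p) by rewrite ler_wpM2l ?(ltW eta0).
have q2 : eta * `|C2| * (2 * `|C1|) <= eta * (k2 * p) * (2 * (k1 * p)).
  exact: ler_pM q0 c1 q1 c1k.
have q3 : delta + W * (eta * `|C2| * (2 * `|C1|))
    <= delta + Kc * (D * Y ^+ 3) * (eta * (k2 * p) * (2 * (k1 * p))).
  by rewrite lerD2l; exact: ler_pM W0 (mulr_ge0 q0 c1) G q2.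
have q4 : eta * C2 * (2 * `|C1|) <= eta * `|C2| * (2 * `|C1|).
  by rewrite ler_wpM2r // ler_wpM2l ?(ltW eta0) ?ler_norm.
apply: (@le_trans _ _ (2 * (k1 * p) * (delta + Kc * (D * Y ^+ 3)
    * ((eta * (k2 * p)) * (2 * (k1 * p)))) * p)).
  rewrite ler_wpM2r ?(ltW p0) //.
  apply: (@le_trans _ _ (2 * `|C1| * (delta + W * (eta * `|C2| * (2 * `|C1|))))).
    by rewrite ler_wpM2l // lerD2l ler_wpM2l.
  apply: (ler_pM c1 _ c1k q3).
  exact: addr_ge0 (ltW d0) (mulr_ge0 W0 (mulr_ge0 q0 c1)).
have -> : 2 * (k1 * p) * (delta + Kc * (D * Y ^+ 3)
    * ((eta * (k2 * p)) * (2 * (k1 * p)))) * p =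
    2 * k1 * (p ^+ 2 * delta) + 4 * k1 ^+ 2 * k2 * Kc * (p ^+ 4 * (D * Y ^+ 3) * eta).
  by ring.
rewrite p2d /T [leRHS]mulrDl lerD2l -[leRHS]mulrA ler_wpM2l //.
have k12 : 0 <= 4 * k1 ^+ 2 by exact: mulr_ge0 (ler0n _ 4) (exprn_ge0 _ (ltW k10)).
exact: mulr_ge0 (mulr_ge0 k12 (ltW k20)) Kc0.
Qed.

End Asymptotics.

Theorem proposition16 (R : realType)
  (mu : forall n : nat, probability (sphere R n) R)
  (mu_uniform : forall n : nat, uniform_sphere (mu n))
  (f : forall d : nat, sphere R d.-1 -> R[i])
  (f_cont : forall d : nat, (2 <= d)%N -> ccontinuous (f d))
  (I : nat -> set nat) (M eps alpha : R)
  (M_gt0 : 0 < M) (eps01 : 0 < eps < 1) (alpha_gt0 : 0 < alpha)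
  (cond1 : exists2 C : nat -> R, C =O_\oo (fun d : nat => d%:R `^ M) &
     forall d : nat, (2 <= d)%N ->
       (l2norm (mu d.-1) (f d)
          <= (C d)%:E * l2norm (mu d.-1) (band_proj (mu d.-1) (I d) (f d)))%E)
  (cond2 : exists2 C : nat -> R, C =O_\oo (fun d : nat => d%:R `^ M) &
     forall d : nat, (2 <= d)%N -> exists c : nat -> R,
       [/\ forall k : nat, I d k -> 0 <= c k,
           forall k : nat, I d k ->
             (supnorm (hproj (mu d.-1) k (f d))
                <= (c k * Num.sqrt (cdim (@harmonics R d.-1 k))%:R)%:E
                   * l2norm (mu d.-1) (f d))%E &
           ((\esum_(k in I d) (c k ^+ 2)%:E) `^ 2^-1
              <= (eps `^ (d%:R `^ alpha) * C d)%:E)%E])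
  (f_sup : (fun d : nat => fine (supnorm (f d))) =O_\oo (fun=> 1 : R))
  (f_l2 : (fun d : nat => fine (l2norm (mu d.-1) (f d)))
            =Omega_\oo (fun d : nat => d%:R `^ (- M)))
  (sigma : R -> R) (sigma_lip : lipschitz sigma) :
  ~ universally_approximable sigma f.
Proof.
move=> [A [B [A0 B0 approx]]].
have [L L0 lipL] : exists2 L : R, 0 <= L &
    forall s t, `|sigma s - sigma t| <= L * `|s - t|.
  have : \forall L \near +oo, 0 <= L /\ L.-lipschitz_setT sigma.
    by near=> L; split; near: L; [exact: nbhs_pinfty_ge|exact: sigma_lip].
  move=> /filter_ex[L [L0 lipL]]; exists L => // s t.
  exact: (lipL (s, t)).
have [C1 /eqOE/eqO_exP[k1 k10 C1k] cond1d] := cond1.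
have [C2 /eqOE/eqO_exP[k2 k20 C2k] cond2d] := cond2.
have [k3 k30 f3] := (eqO_exP _ _ _).1 (eqOE f_sup).
(* An Omega bound is an O bound read backwards, so the constant is inverted. *)
have [k4 k40 f4] : exists2 k4 : R, 0 < k4 & \forall d \near \oo,
    k4 * `|d%:R `^ (- M)| <= `|fine (l2norm (mu d.-1) (f d))|.
  have := f_l2; rewrite eqOmegaE eqOmegaO => /eqOE/eqO_exP[k k0 kP].
  exists k^-1; first by rewrite invr_gt0.
  by apply: filterS kP => d; rewrite ler_pdivrMl.
have [D0 D0P] := exponential_beats_polynomial M_gt0 alpha_gt0 eps01 k10 k20
  (ltW k30) k40 L0 A0 B0.
near \oo => d.
(* The zonal argument requires 1 < n with n = d - 1, which holds for large d. *)
have d3 : (3 <= d)%N by near: d; exact: nbhs_infty_ge.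
have d2 : (2 <= d)%N by exact: ltnW.
have D1 : 1 <= d%:R :> R by rewrite ler1n ltnW.
have Dp : 0 < d%:R :> R by exact: lt_le_trans D1.
have dE : d.-1.+1 = d by rewrite prednK // (ltnW d2).
(* Eventually below the order d^(-2M) of the lower bound on the norm of P_I f, yet polynomial, so
   that the network size stays polynomial in d. *)
pose delta : R := d%:R `^ (- (2 * M + 1)).
have delta0 : 0 < delta by rewrite powR_gt0.
have delta1 : delta < 1.
  rewrite /delta powRN invf_lt1 ?powR_gt0 //.
  apply: (@lt_le_trans _ _ d%:R); first by rewrite ltr1n.
  by rewrite -{1}[d%:R]powRr1 ?(ltW Dp) // ler_powR // lerDr mulr_ge0 // ltW.
have [N [u [a [b [fnet NX]]]]] := approx d d2 delta (introT andP (conj delta0 delta1)).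
set X := A * _ in NX.
have [c [c0 hc cE]] := cond2d d d2.
have W0 : 0 <= max_weight u a.
  by rewrite /max_weight le_max; apply/orP; left; exact: bigmax_ge_id.
have l2ge : 0 <= fine (l2norm (mu d.-1) (f d)) by rewrite fine_ge0 // Lnorm_ge0.
have F4 : k4 * d%:R `^ (- M) <= fine (l2norm (mu d.-1) (f d)).
  rewrite -[leRHS]ger0_norm // -[_ `^ _]ger0_norm ?powR_ge0 //.
  by near: d; exact: f4.
have F0 : 0 < fine (l2norm (mu d.-1) (f d)).
  by apply: lt_le_trans F4; rewrite mulr_gt0 // powR_gt0.
have := @dimension_bound R d.-1 (mu d.-1) (mu_uniform d.-1) _ sigma L L0 lipL
  (f d) (I d) c (C1 d) _ delta X k3 N u a b (f_cont d d2) (cond1d d d2) c0 hc cE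
  delta0 fnet _ _ _ F0.
rewrite dE => key; apply: (D0P d%:R _ (C1 d) (C2 d) D1 _ F4).
- by near: d; exact: nbhs_infty_gtr.
- rewrite -[d%:R `^ M]ger0_norm ?powR_ge0 //; near: d; exact: C1k.
- rewrite -[d%:R `^ M]ger0_norm ?powR_ge0 //; near: d; exact: C2k.
apply: key.
- by rewrite -ltnS dE.
- by apply: le_trans NX; rewrite lerDl.
- by apply: le_trans NX; rewrite lerDr.
- apply: (le_trans (ler_norm _)); rewrite -[leRHS]mulr1 -[1 in leRHS]normr1.
  by near: d; exact: f3.
Unshelve. all: by end_near.
Qed.
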